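(* For any regular oriented matroid $N=(A,\mathfrak{C})$, with all sums over ordered partitions $R\uplus S\uplus T=A$ of the ground set into three (possibly empty) disjoint subsets: \begin{align*} \sum_{R\uplus S\uplus T=A}y^{|S|}z^{|T|}q^{\mathrm{rk}(N)-\mathrm{rk}(N_{\setminus R})}\chi^>_{{}_{-T}N_{\setminus R}}(q)&=\mathcal{A}_N(q,1+y,1+z),\\ \sum_{R\uplus S\uplus T=A}y^{|S|}z^{|T|}q^{\mathrm{rk}(N)-\mathrm{rk}(N_{\setminus R})}\chi^\geq_{{}_{-T}N_{\setminus R}}(q)&=(1+y+z)^{|A|}\mathcal{A}_N\!\left(q,\tfrac{1+y}{1+y+z},\tfrac{1+z}{1+y+z}\right),\\ \sum_{R\uplus S\uplus T=A}y^{|S|}z^{|T|}\chi^>_{{}_{-T}N_{/R}}(q)&=\mathcal{A}_N(q,y,z),\\ \sum_{R\uplus S\uplus T=A}y^{|S|}z^{|T|}\chi^\geq_{{}_{-T}N_{/R}}(q)&=(1+y+z)^{|A|}\mathcal{A}_N\!\left(q,\tfrac{y}{1+y+z},\tfrac{z}{1+y+z}\right). \end{align*}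
   Context: An oriented matroid $N=(A,\mathfrak{C})$ has signed circuits $C=(C^+,C^-)$; it is regular if representable over $\mathbb{R}$ by a totally unimodular matrix. For a positive integer $q$, a $q$-coflow is $f:A\to\mathbb{Z}/q\mathbb{Z}$ with $\sum_{a\in C^+}f(a)-\sum_{a\in C^-}f(a)=0$ for all $C$; $f_A^>$ (resp. $f_A^<$) is the set of $a$ with $f(a)$ (resp. $-f(a)$) congruent mod $q$ to an element of $\{1,\ldots,\lfloor q/2\rfloor\}$. The $A$-polynomial $\mathcal{A}_N(q,y,z)$ is the unique polynomial with $\mathcal{A}_N(q,y,z)=\sum_{f\ q\text{-coflow}}y^{|f_A^>|}z^{|f_A^<|}$ for all odd positive $q$. The strict-characteristic polynomial $\chi^>_N$ and weak-characteristic polynomial $\chi^\geq_N$ are the polynomials such that for every odd positive integer $q$, $\chi^>_N(q)$ is the number of $q$-coflows $f$ with $f(a)\in\{1,\ldots,\lfloor q/2\rfloor\}$ for all $a\in A$, and $\chi^\geq_N(q)$ is the number of $q$-coflows with $f(a)\in\{0,1,\ldots,\lfloor q/2\rfloor\}$ for all $a$ (such polynomials exist and are unique). ${}_{-T}N$ is the reorientation of $N$ on $T$ (signs of elements of $T$ flipped in every signed circuit), $N_{\setminus R}$ and $N_{/R}$ are deletion and contraction of $R$, and $\mathrm{rk}$ denotes matroid rank (of the whole oriented matroid). *)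

(* Defs.v *)
From mathcomp Require Import all_boot all_order all_algebra.
From mathcomp Require Import mpoly reals.
From Stdlib Require Import ClassicalEpsilon.

Set Implicit Arguments.
Unset Strict Implicit.
Unset Printing Implicit Defensive.

Import Order.TTheory GRing.Theory Num.Theory.
Local Open Scope ring_scope.

(* Sign data on a finite ground set contained in an ambient finite type: a    *)
(* signed set is the pair (C^+, C^-). The ground set is a field of the record *)
(* so that minors live over the same ambient type.                            *)
Record signed_system (V : finType) := SignedSystem {
  ground : {set V};
  circuits : {set {set V} * {set V}} }.

Definition supp (V : finType) (C : {set V} * {set V}) : {set V} :=
  C.1 :|: C.2.

Definition opp_signed (V : finType) (C : {set V} * {set V}) :
  {set V} * {set V} := (C.2, C.1).

(* The signed circuit axioms, the last one being weak circuit elimination. *)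
Definition oriented_matroid (V : finType) (N : signed_system V) : Prop :=
  [/\ forall C, C \in circuits N ->
        [/\ supp C \subset ground N, [disjoint C.1 & C.2] & supp C != set0],
      forall C, C \in circuits N -> opp_signed C \in circuits N,
      forall C D, C \in circuits N -> D \in circuits N ->
        supp C \subset supp D -> C = D \/ C = opp_signed D
    & forall C D e, C \in circuits N -> D \in circuits N ->
        C != opp_signed D -> e \in C.1 -> e \in D.2 ->
        exists2 Z, Z \in circuits N &
          Z.1 \subset (C.1 :|: D.1) :\ e /\ Z.2 \subset (C.2 :|: D.2) :\ e].

Definition totally_unimodular (R : realType) (m n : nat) (M : 'M[R]_(m, n)) :
  Prop :=
  forall (k : nat) (f : 'I_k -> 'I_m) (g : 'I_k -> 'I_n),
    injective f -> injective g -> \det (mxsub f g M) \in [:: -1; 0; 1].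

(* Entry j of d is the coefficient of the j-th element of E. *)
Definition signed_support (R : realType) (V : finType) (E : {set V})
    (d : 'cV[R]_#|E|) : {set V} * {set V} :=
  ([set enum_val j | j : 'I_#|E| & 0 < d j 0],
   [set enum_val j | j : 'I_#|E| & d j 0 < 0]).

(* The columns of M are indexed by the ground set, and the signed circuits    *)
(* are the signed supports of the minimal linear dependencies of the columns. *)
Definition represents (R : realType) (V : finType) (N : signed_system V)
    (m : nat) (M : 'M[R]_(m, #|ground N|)) : Prop :=
  forall C, C \in circuits N <->
    exists d : 'cV[R]_#|ground N|,
      [/\ M *m d = 0, d != 0, C = signed_support d
        & forall d' : 'cV[R]_#|ground N|, M *m d' = 0 -> d' != 0 ->
            supp (signed_support d') \subset supp C ->
            supp (signed_support d') = supp C].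

Definition regular (R : realType) (V : finType) (N : signed_system V) : Prop :=
  oriented_matroid N /\
  exists (m : nat) (M : 'M[R]_(m, #|ground N|)),
    totally_unimodular M /\ represents M.

Definition independent (V : finType) (N : signed_system V) (I : {set V}) :
  bool :=
  (I \subset ground N) && [forall C in circuits N, ~~ (supp C \subset I)].

Definition rk (V : finType) (N : signed_system V) : nat :=
  (\max_(I : {set V} | independent N I) #|I|)%N.

Definition reorient_signed (V : finType) (T : {set V})
    (C : {set V} * {set V}) : {set V} * {set V} :=
  ((C.1 :\: T) :|: (C.2 :&: T), (C.2 :\: T) :|: (C.1 :&: T)).

Definition reorientation (V : finType) (T : {set V}) (N : signed_system V) :
  signed_system V :=
  SignedSystem (ground N) [set reorient_signed T C | C in circuits N].

Definition deletion (V : finType) (R : {set V}) (N : signed_system V) :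
  signed_system V :=
  SignedSystem (ground N :\: R)
    [set C in circuits N | [disjoint supp C & R]].

Definition restrict_signed (V : finType) (R : {set V})
    (C : {set V} * {set V}) : {set V} * {set V} := (C.1 :\: R, C.2 :\: R).

(* The signed circuits of N / R are the nonempty signed sets C \ R, with C a  *)
(* signed circuit of N, whose support is minimal.                             *)
Definition contraction (V : finType) (R : {set V}) (N : signed_system V) :
  signed_system V :=
  let traces := [set C in [set restrict_signed R C | C in circuits N]
                   | supp C != set0] in
  SignedSystem (ground N :\: R)
    [set C in traces |
       [forall D in traces, (supp D \subset supp C) ==> (supp D == supp C)]].

(* Z/qZ is encoded by the representatives 'I_q, which is also correct for     *)
(* q = 1, unlike 'Z_q.                                                        *)
Definition residue_map (V : finType) (N : signed_system V) (q : nat) :=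
  {ffun {a : V | a \in ground N} -> 'I_q}.

Definition coflow (V : finType) (N : signed_system V) (q : nat)
    (f : residue_map N q) : bool :=
  [forall C in circuits N,
     (\sum_(a | val a \in C.1) f a == \sum_(a | val a \in C.2) f a %[mod q])%N].

Definition gt_part (V : finType) (N : signed_system V) (q : nat)
    (f : residue_map N q) : {set {a : V | a \in ground N}} :=
  [set a | (0 < f a <= q./2)%N].

Definition lt_part (V : finType) (N : signed_system V) (q : nat)
    (f : residue_map N q) : {set {a : V | a \in ground N}} :=
  [set a | (0 < (q - f a) %% q <= q./2)%N].

(* In the polynomials below K is meant to be a field of characteristic 0; the *)
(* defining properties then determine the polynomials, and the identity in    *)
(* K[y, z] for a fixed q amounts to the equality of values at all y, z in K.  *)
(* For the P satisfying such a property, epsilon returns one if it exists.    *)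
Definition is_A_polynomial (K : fieldType) (V : finType) (N : signed_system V)
    (P : {mpoly K[3]}) : Prop :=
  forall q : nat, odd q -> forall y z : K,
    P.@[tnth [tuple q%:R; y; z]] =
      \sum_(f : residue_map N q | coflow f)
         y ^+ #|gt_part f| * z ^+ #|lt_part f|.

Definition A_polynomial (K : fieldType) (V : finType) (N : signed_system V) :
  {mpoly K[3]} := epsilon (inhabits 0) (is_A_polynomial (K := K) N).

Definition is_strict_char_polynomial (K : fieldType) (V : finType)
    (N : signed_system V) (P : {poly K}) : Prop :=
  forall q : nat, odd q ->
    P.[q%:R] = #|[set f : residue_map N q |
                    coflow f & [forall a, (0 < f a <= q./2)%N]]|%:R.

Definition strict_char_polynomial (K : fieldType) (V : finType)
    (N : signed_system V) : {poly K} :=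
  epsilon (inhabits 0) (is_strict_char_polynomial (K := K) N).

Definition is_weak_char_polynomial (K : fieldType) (V : finType)
    (N : signed_system V) (P : {poly K}) : Prop :=
  forall q : nat, odd q ->
    P.[q%:R] = #|[set f : residue_map N q |
                    coflow f & [forall a, (f a <= q./2)%N]]|%:R.

Definition weak_char_polynomial (K : fieldType) (V : finType)
    (N : signed_system V) : {poly K} :=
  epsilon (inhabits 0) (is_weak_char_polynomial (K := K) N).

Definition ordered_partition3 (V : finType) (E R S T : {set V}) : bool :=
  [&& [disjoint R & S], [disjoint R & T], [disjoint S & T]
    & R :|: S :|: T == E].

(* Main.v *)
(* Over the odd q, both sides count q-coflows f by sign pattern: the sum over
   (R, S, T) distributes over the elements a of the ground set, each f
   contributing a product of factors that depend on the sign of f a only. For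
   contractions this uses that the coflows of N / R are those of N vanishing on
   R, and for deletions that the map from coflows of N to coflows of N \ R has
   fibres of size q ^ (rk N - rk (N \ R)).

   It remains to see that the polynomials exist, that is, that the number of
   coflows with a given pattern is a polynomial in q odd. Doubling modulo q makes
   them lattice points y of [0, q]^A with prescribed parities and circuit sums
   q c, on a given face of the cube. By total unimodularity there is a 0/1 point
   v with circuit sums c on the same face as soon as there is any y; the
   translation y |-> y + v then relates the counts for q and q + 1 up to points
   lying on smaller faces, and induction on the dimension of the face applies. *)

Require Import Defs.
From mathcomp Require Import all_boot all_order all_algebra.
From mathcomp Require Import mpoly reals.
From mathcomp Require Import zify ring lra.
From Stdlib Require Import ClassicalEpsilon.

Set Implicit Arguments.
Unset Strict Implicit.
Unset Printing Implicit Defensive.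

Import Order.TTheory GRing.Theory Num.Theory.
Local Open Scope ring_scope.

(** * Regular matroids and total unimodularity *)

(** For odd q, doubling turns the condition of lying in the lower half of the nonzero residues into
    a parity condition, while the vanishing of a coordinate stays a face of the cube. In exchange,
    translation by a 0/1 vector alters the parities, and only two successive translations lead back
    to the same counting problem. The recursions therefore have step 2 and yield polynomials on one
    parity class. Characteristic 0 is what allows these recursions to be solved, and later what
    allows passing from odd integers to arbitrary q. The entries of a circuit's sign vector on its
    support are units modulo every q. So a circuit can clear any one of its coordinates in an
    integer dependency, with integer coefficients; lifting coflows from minors rests on this. Counts
    for reorientations, deletions and contractions are all rewritten as counts of coflows of N with
    constraints on the signs. The polynomials of a contraction thus exist because those of N do, and
    no vector representation of the contraction is constructed. *)

Lemma tu_circuit_ratio (F : realType) (m n : nat) (M : 'M[F]_(m, n))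
    (d : 'cV[F]_n) (i j : 'I_n) :
  totally_unimodular M -> M *m d = 0 ->
  (forall d' : 'cV_n, M *m d' = 0 -> d' != 0 ->
     (forall j, d' j 0 != 0 -> d j 0 != 0) ->
     forall j, d j 0 != 0 -> d' j 0 != 0) ->
  d i 0 != 0 -> d j 0 != 0 -> d j 0 / d i 0 \in [:: -1; 0; 1].
Proof.
move=> tuM Md0 mind di0 dj0.
have [->|nji] := eqVneq j i; first by rewrite divff // !inE eqxx !orbT.
pose J := [set j | d j 0 != 0] :\ i.
pose g (l : 'I_#|J|) := enum_val l.
have g_inj : injective g by apply: enum_val_inj.
have gP l : g l != i /\ d (g l) 0 != 0.
  by have := enum_valP l; rewrite !inE => /andP.
have sumJ (u : 'I_n -> F) : (forall j, j \notin J -> u j = 0) ->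
    \sum_j u j = \sum_l u (g l).
  move=> u0; rewrite (bigID (mem J)) /= [X in _ + X]big1 ?addr0; last first.
    by move=> l /u0.
  by rewrite big_enum_val.
pose B0 := colsub g M.
(* A dependency among the columns in [J], extended by zero, would vanish at [i]; minimality of the
   support of [d] forbids this. *)
have B0full : row_full B0.
  rewrite /row_full -mxrank_tr; apply: inj_row_free => v vB0.
  pose d' : 'cV_n := \col_j' \sum_(l | g l == j') v 0 l.
  have d'g l : d' (g l) 0 = v 0 l.
    rewrite mxE (big_pred1 l) // => l'; exact: inj_eq.
  have d'J j' : j' \notin J -> d' j' 0 = 0.
    move=> j'J; rewrite mxE big1 // => l /eqP gl.
    by rewrite -gl enum_valP in j'J.
  have Md'0 : M *m d' = 0.
    apply/matrixP=> r c; rewrite mxE ord1 sumJ => [|j' j'J]; last first.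
      by rewrite d'J ?mulr0.
    have /matrixP/(_ 0 r) := vB0; rewrite mxE [in RHS]mxE => e.
    rewrite [RHS]mxE -[RHS]e.
    by apply: eq_bigr => l _; rewrite d'g !mxE mulrC.
  apply/rowP=> l; rewrite mxE; apply/eqP/negPn/negP => vl0.
  have d'n0 : d' != 0.
    by apply/eqP=> /matrixP/(_ (g l) 0); rewrite d'g mxE => /eqP; apply/negP.
  suff : d' i 0 != 0 by rewrite d'J ?eqxx // !inE eqxx.
  apply: (mind d') => // j'; apply: contraNneq => dj'; rewrite d'J //.
  by rewrite !inE dj' eqxx andbF.
pose f := fullrankfun B0full.
have f_inj : injective f by apply: fullrankfun_inj.
pose B := mxsub f g M.
have Bunit : B \in unitmx.
  have -> : B = rowsub f B0 by apply/matrixP=> r c; rewrite !mxE.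
  exact: fullrowsub_unit.
pose b : 'cV_(#|J|) := \col_r M (f r) i.
pose x : 'cV_(#|J|) := \col_l (d (g l) 0 / d i 0).
have Bx : B *m x = - b.
  apply/matrixP=> r c; rewrite !mxE.
  have /matrixP/(_ (f r) 0) := Md0; rewrite !mxE (bigD1 i) //=.
  move=> /eqP; rewrite addrC addr_eq0 => /eqP sumE.
  under eq_bigr do rewrite !mxE mulrA.
  rewrite -mulr_suml; apply: (mulIf di0); rewrite mulfVK // mulNr -sumE.
  rewrite big_mkcond [RHS]big_mkcond.
  rewrite (sumJ (fun l => if l != i then M (f r) l * d l 0 else 0)).
    by apply: eq_bigr => l _ /=; have [-> _] := gP l.
  move=> l; rewrite !inE negb_and negbK => /orP[/eqP ->|]; first by rewrite eqxx.
  by rewrite negbK => /eqP ->; rewrite mulr0 if_same.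
have jJ : j \in J by rewrite !inE nji dj0.
pose l := enum_rank_in jJ j.
have gl : g l = j by rewrite /g enum_rankK_in.
(* Cramer's rule: with column [l] of [B] replaced by column [i] of [M], the ratio is minus the
   quotient of two minors. *)
pose g' (l' : 'I_#|J|) := if l' == l then i else g l'.
have g'_inj : injective g'.
  move=> l1 l2; rewrite /g'.
  case: eqP => [->|n1]; case: eqP => [->|n2] // e.
  - by have [] := gP l2; rewrite -e eqxx.
  - by have [] := gP l1; rewrite e eqxx.
  - exact: g_inj.
have := mul_adj_mx B; move/(congr1 (mulmx^~ x)); rewrite -mulmxA Bx mul_scalar_mx.
move=> /matrixP/(_ l 0); rewrite [RHS]mxE mulmxN mxE => adjE.
have detE : \det (mxsub f g' M) = (\adj B *m b) l 0.
  rewrite (expand_det_col _ l) mxE; apply: eq_bigr => r _.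
  rewrite !mxE /g' eqxx mulrC; congr (_ * _); rewrite /cofactor; congr (_ * \det _).
  by apply/matrixP=> r' c'; rewrite !mxE eq_sym (negPf (neq_lift _ _)).
have := tuM _ f g f_inj g_inj; have := tuM _ f g' f_inj g'_inj.
have detB0 : \det B != 0 by rewrite -unitfE; move: Bunit; rewrite unitmxE.
have -> : d j 0 / d i 0 = - \det (mxsub f g' M) / \det B.
  by rewrite detE adjE mxE gl [RHS]mulrC mulKf.
rewrite !inE => /or3P[] /eqP-> /or3P[/eqP e|/eqP e|/eqP e];
  rewrite -/B in e; rewrite e in detB0 *; rewrite ?eqxx // in detB0 *;
  by rewrite ?opprK ?oppr0 ?divr1 ?mul0r ?invrN1 ?mulN1r ?mul1r ?opprK ?eqxx ?orbT.
Qed.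

Definition chi (V : finType) (C : {set V} * {set V}) (a : V) : int :=
  (a \in C.1)%:Z - (a \in C.2)%:Z.

(* N has the matroid of the vectors [phi a]; that the sign vectors of the
   circuits are themselves dependencies is all that is retained of total
   unimodularity. *)
Definition vector_matroid (F : realFieldType) (V : finType)
    (N : signed_system V) (m : nat) (phi : V -> 'rV[F]_m) : Prop :=
  (forall C, C \in circuits N ->
     [/\ supp C \subset ground N, [disjoint C.1 & C.2],
       \sum_a (chi C a)%:~R *: phi a = 0 & supp C != set0]) /\
  (forall x : V -> F, (forall a, a \notin ground N -> x a = 0) ->
     \sum_a x a *: phi a = 0 -> forall a, x a != 0 ->
     exists C, [/\ C \in circuits N, a \in supp C
       & forall b, b \in supp C -> x b != 0]).

Definition unimodular (F : realFieldType) (V : finType) (N : signed_system V) :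
  Prop := exists (m : nat) (phi : V -> 'rV[F]_m), vector_matroid N phi.

Lemma chi_eq0 (V : finType) (C : {set V} * {set V}) (a : V) :
  [disjoint C.1 & C.2] -> (chi C a == 0) = (a \notin supp C).
Proof.
move=> dC; rewrite /chi inE.
by case: (boolP (a \in C.1)) => a1; [rewrite (disjointFr dC a1) | case: (a \in C.2)].
Qed.

Lemma chi_sqr (V : finType) (C : {set V} * {set V}) (a : V) :
  [disjoint C.1 & C.2] -> a \in supp C -> chi C a * chi C a = 1.
Proof.
move=> dC; rewrite /chi inE.
by case: (boolP (a \in C.1)) => a1; [rewrite (disjointFr dC a1) | move=> /= ->].
Qed.

(** A failure of minimality shortens the support. The witness [d'] replaces [d] if it is nonzero at
    [i]; otherwise a multiple of [d'] is subtracted, clearing some coordinate of [d] without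
    touching the one at [i]. *)
Lemma minimal_dependency (F : fieldType) (m n : nat) (M : 'M[F]_(m, n))
    (d : 'cV[F]_n) (i : 'I_n) :
  M *m d = 0 -> d i 0 != 0 ->
  exists d1 : 'cV_n, [/\ M *m d1 = 0, d1 i 0 != 0,
    forall j, d1 j 0 != 0 -> d j 0 != 0
    & forall d' : 'cV_n, M *m d' = 0 -> d' != 0 ->
       (forall j, d' j 0 != 0 -> d1 j 0 != 0) ->
       forall j, d1 j 0 != 0 -> d' j 0 != 0].
Proof.
have [k] := ubnP #|[set j | d j 0 != 0]|.
elim: k d => // k IHk d; rewrite ltnS => dk Md0 di0.
have smaller (d2 : 'cV_n) b : M *m d2 = 0 -> d2 i 0 != 0 ->
    (forall j, d2 j 0 != 0 -> d j 0 != 0) -> d b 0 != 0 -> d2 b 0 = 0 ->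
    exists d1 : 'cV_n, [/\ M *m d1 = 0, d1 i 0 != 0,
    forall j, d1 j 0 != 0 -> d j 0 != 0
    & forall d' : 'cV_n, M *m d' = 0 -> d' != 0 ->
       (forall j, d' j 0 != 0 -> d1 j 0 != 0) ->
       forall j, d1 j 0 != 0 -> d' j 0 != 0].
  move=> Md2 d2i sub db d2b.
  have [||//|d1 [Md1 d1i sub1 min1]] := IHk d2.
  - apply: leq_trans dk; apply: proper_card; apply/properP; split.
      by apply/subsetP=> j; rewrite !inE; apply: sub.
    by exists b; rewrite !inE ?d2b ?eqxx.
  - by [].
  by exists d1; split=> // j /sub1/sub.
case: (classic (forall d' : 'cV_n, M *m d' = 0 -> d' != 0 ->
       (forall j, d' j 0 != 0 -> d j 0 != 0) ->
       forall j, d j 0 != 0 -> d' j 0 != 0)) => [mind|].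
  by exists d; split.
move=> nmin; apply: NNPP => nex; apply: nmin => d' Md' d'n0 sub j dj.
apply/negP => /eqP d'j.
have [d'i|d'i] := eqVneq (d' i 0) 0; last by apply: nex; apply: (smaller d' j).
have [b d'b] : exists b, d' b 0 != 0.
  by case/cV0Pn: d'n0 => b; exists b.
apply: nex; apply: (smaller (d - (d b 0 / d' b 0) *: d') b).
- by rewrite mulmxBr -scalemxAr Md0 Md' scaler0 subr0.
- by rewrite !mxE d'i mulr0 subr0.
- move=> l; rewrite !mxE; apply: contraNneq => dl.
  have [->|/sub] := eqVneq (d' l 0) 0; first by rewrite dl mulr0 subr0.
  by rewrite dl eqxx.
- exact: sub.
- by rewrite !mxE divfK // subrr.
Qed.

(** By the ratio lemma the nonzero entries of a minimal dependency have equal absolute value, so it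
    is a multiple of its sign vector. Off the ground set [phi] is zero, as an empty sum. *)
Lemma regular_unimodular (RR : realType) (V : finType) (N : signed_system V) :
  regular RR N -> unimodular RR N.
Proof.
move=> [[circN _ _ _] [m [M [tuM repM]]]].
set n := #|ground N| in M tuM repM.
pose ev (j : 'I_n) : V := enum_val j.
have evE j : ev j \in ground N by apply: enum_valP.
have ev_inj : injective ev by apply: enum_val_inj.
pose phi a : 'rV[RR]_m := \row_r \sum_(j | ev j == a) M r j.
have depE (x : V -> RR) :
    \sum_a x a *: phi a = (M *m \col_j x (ev j))^T.
  apply/rowP=> r; rewrite summxE mxE mxE.
  under eq_bigr do rewrite !mxE mulr_sumr.
  rewrite (exchange_big_dep predT) //=; apply: eq_bigr => j _.
  by rewrite (big_pred1 (ev j)) ?mxE 1?mulrC // => a; rewrite eq_sym.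
have suppE (d : 'cV[RR]_n) j :
    (ev j \in supp (signed_support d)) = (d j 0 != 0).
  rewrite !inE neq_lt orbC; congr (_ || _); apply/imsetP/idP.
  - by case=> l; rewrite inE => dl /ev_inj->.
  - by move=> dj; exists j; rewrite ?inE.
  - by case=> l; rewrite inE => dl /ev_inj->.
  - by move=> dj; exists j; rewrite ?inE.
have suppP (d : 'cV[RR]_n) a : a \in supp (signed_support d) ->
    exists2 j, a = ev j & d j 0 != 0.
  move=> ad; have [j aj] : exists j, a = ev j.
    by move: ad; rewrite !inE => /orP[] /imsetP[j _ ->]; exists j.
  by exists j; rewrite // -suppE -aj.
exists m, phi; split=> [C CN|x x0 xdep a xa].
  have [subC disC nC] := circN C CN; split=> //.
  have [d [Md dn0 defC mind]] := (repM C).1 CN.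
  have mind' (d' : 'cV_n) : M *m d' = 0 -> d' != 0 ->
     (forall j, d' j 0 != 0 -> d j 0 != 0) ->
     forall j, d j 0 != 0 -> d' j 0 != 0.
    move=> Md' d'n0 sub j; rewrite -!suppE -defC => jC.
    rewrite mind //; apply/subsetP=> a /suppP[l ->].
    by move/sub; rewrite -suppE -defC.
  have [i di] := cV0Pn d dn0.
  rewrite depE.
  (* Scaling by the absolute value, not by [d i 0] itself, keeps the signs of [d]. *)
  suff -> : \col_j (chi C (ev j))%:~R = `|d i 0|^-1 *: d.
    by rewrite -scalemxAr Md scaler0 trmx0.
  apply/colP=> j; rewrite !mxE.
  have -> : (chi C (ev j))%:~R = Num.sg (d j 0).
    have in1 : (ev j \in C.1) = (0 < d j 0).
      rewrite defC; apply/imsetP/idP => [[l]|dj]; last by exists j; rewrite ?inE.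
      by rewrite inE => dl /ev_inj->.
    have in2 : (ev j \in C.2) = (d j 0 < 0).
      rewrite defC; apply/imsetP/idP => [[l]|dj]; last by exists j; rewrite ?inE.
      by rewrite inE => dl /ev_inj->.
    by rewrite /chi in1 in2; case: sgrP.
  have [->|dj] := eqVneq (d j 0) 0; first by rewrite sgr0 mulr0.
  have := tu_circuit_ratio tuM Md mind' di dj.
  have ni : `|d i 0| != 0 by rewrite normr_eq0.
  rewrite !inE => /or3P[] /eqP e; have dE : d j 0 = (d j 0 / d i 0) * d i 0
    by rewrite divfK.
  - by rewrite dE e mulN1r sgrN mulrN; congr (- _); apply: (mulfI ni);
       rewrite mulVKf // mulrC -numEsg.
  - by move: dj; rewrite dE e mul0r eqxx.
  - by rewrite dE e mul1r; apply: (mulfI ni); rewrite mulVKf // mulrC -numEsg.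
have aE : a \in ground N by apply: contraNT xa => /x0->.
pose i := enum_rank_in aE a.
have evi : ev i = a by rewrite /ev enum_rankK_in.
have Md : M *m (\col_j x (ev j)) = 0.
  by apply: trmx_inj; rewrite -depE xdep trmx0.
have di : (\col_j x (ev j)) i 0 != 0 by rewrite mxE evi.
have [d1 [Md1 d1i sub1 min1]] := minimal_dependency Md di.
exists (signed_support d1); split.
- apply/repM; exists d1; split=> //.
    by apply/eqP=> d10; rewrite d10 mxE eqxx in d1i.
  move=> d' Md' d'n0 sub; apply/eqP; rewrite eqEsubset sub /=.
  apply/subsetP=> b /suppP[j -> d1j]; rewrite suppE.
  apply: min1 => // l; rewrite -!suppE; apply: (subsetP sub).
- by rewrite -evi suppE.
- by move=> b /suppP[j -> /sub1]; rewrite mxE.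
Qed.

Lemma unimodular_deletion (F : realFieldType) (V : finType)
    (N : signed_system V) (R : {set V}) :
  unimodular F N -> unimodular F (deletion R N).
Proof.
move=> [m [phi [circN depN]]]; exists m, phi; split=> [C|x x0 xdep a xa].
  rewrite inE => /andP[CN CR]; have [subC dC depC nC] := circN C CN; split=> //=.
  by rewrite subsetD subC.
have [|//|//|C [CN aC subC]] := depN x _ _ a.
  by move=> b bN; apply: x0; rewrite inE (negPf bN) andbF.
exists C; split=> //; rewrite inE CN disjoint_subset; apply/subsetP=> b /subC.
by apply: contraNN => bR; rewrite x0 // !inE bR.
Qed.

(** Either [phi a] lies in the span of the vectors of [X], which gives a dependency through [a] and
    hence a circuit, or a linear form vanishes on that span but not at [phi a]. The values of this
    form on the vectors are orthogonal to every dependency. *)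
Lemma unimodular_closure (F : realFieldType) (V : finType)
    (N : signed_system V) (X : {set V}) (a : V) :
  unimodular F N -> X \subset ground N -> a \in ground N -> a \notin X ->
  (exists C, [/\ C \in circuits N, a \in supp C & supp C \subset a |: X]) \/
  (exists d : V -> F, [/\ forall b, b \in X -> d b = 0, d a != 0
     & forall C, C \in circuits N -> \sum_b (chi C b)%:~R * d b = 0]).
Proof.
move=> [m [phi [circN depN]]] XE aE aX.
pose U := (\sum_(b in X) <<phi b>>)%MS.
have [/sub_sumsmxP[u phia]|] := boolP (phi a <= U)%MS.
  left.
  have /fin_all_exists [y yE] (b : V) : exists y, u b *m <<phi b>>%MS = y *: phi b.
    by apply/sub_rVP; apply: submx_trans (submxMl _ _) _; rewrite genmxE.
  pose x b := if b == a then 1 else if b \in X then - y b else 0.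
  have xa : x a != 0 by rewrite /x eqxx oner_neq0.
  have [||//|C [CN aC subC]] := depN x _ _ a.
  - move=> b bE; rewrite /x; have [ba|_] := eqVneq b a.
      by rewrite ba aE in bE.
    by case: ifP => // bX; rewrite (subsetP XE) in bE.
  - rewrite (bigD1 a) //= {1}/x eqxx scale1r phia.
    rewrite [X in _ + X](eq_bigr (fun b => if b \in X then - (y b *: phi b) else 0)).
      rewrite -big_mkcondr /= sumrN.
      rewrite [X in _ - X](eq_bigl (mem X)) => [|b].
        by rewrite (eq_bigr _ (fun b _ => yE b)) subrr.
      by rewrite /=; case: eqVneq => //= ->; rewrite (negPf aX).
    by move=> b ba; rewrite /x (negPf ba); case: ifP; rewrite ?scaleNr ?scale0r.
  exists C; split=> //; apply/subsetP=> b /subC; rewrite /x !inE.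
  by case: (b == a); case: (b \in X) => //; rewrite eqxx.
rewrite submxE => /rV0Pn[j aj]; right.
exists (fun b => (phi b *m cokermx U) 0 j); split=> // [b bX|C CN].
  have : (phi b <= U)%MS.
    by rewrite (sumsmx_sup b) // genmxE.
  by rewrite submxE => /eqP->; rewrite mxE.
have [_ _ depC _] := circN C CN.
move/(congr1 (mulmx^~ (cokermx U))): depC.
rewrite mul0mx mulmx_suml => /rowP/(_ j); rewrite summxE [RHS]mxE => e.
by rewrite -[RHS]e; apply: eq_bigr => b _; rewrite -scalemxAl [RHS]mxE.
Qed.

(* Hoffman-Kruskal: while t has fractional coordinates, move it along a vector
   d orthogonal to the circuits and supported on these coordinates; if there is
   no such d, some fractional coordinate is the only one on a circuit, hence is
   an integer. *)
Lemma unimodular_rounding (F : realFieldType) (V : finType)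
    (N : signed_system V) (c : {set V} * {set V} -> int) (t : V -> F) :
  unimodular F N ->
  (forall a, a \notin ground N -> t a = 0) -> (forall a, 0 <= t a <= 1) ->
  (forall C, C \in circuits N ->
     \sum_a (chi C a)%:~R * t a = (c C)%:~R) ->
  exists v : V -> bool,
    [/\ forall C, C \in circuits N -> \sum_a chi C a * (v a)%:Z = c C,
      forall a, t a = 0 -> v a = false & forall a, t a = 1 -> v a].
Proof.
move=> uN; have [k] := ubnP #|[set a | 0 < t a < 1]|.
elim: k t => // k IHk t; rewrite ltnS => tk t0 t01 tc.
pose S := [set a | 0 < t a < 1].
have tX b : b \notin S -> t b = (t b == 1)%:Z%:~R.
  rewrite inE negb_and -!leNgt; have /andP[t_ge0 t_le1] := t01 b.
  case/orP => [t_le0|t_ge1].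
    have -> : t b = 0 by apply/eqP; rewrite eq_le t_le0.
    by rewrite eq_sym oner_eq0.
  have -> : t b = 1 by apply/eqP; rewrite eq_le t_le1.
  by rewrite eqxx.
have [S0|[a aS]] := set_0Vmem S.
  exists (fun a => t a == 1); split=> [C CN|b ->|b ->]; last 2 first.
  - by rewrite eq_sym oner_eq0.
  - by rewrite eqxx.
  apply: (intr_inj (R := F)); rewrite -tc // rmorph_sum; apply: eq_bigr => b _.
  by rewrite rmorphM /= -tX // S0 inE.
have aE : a \in ground N.
  by apply: contraTT aS => /t0 ta; rewrite inE ta ltxx.
have XE : ground N :\: S \subset ground N by apply: subsetDl.
have aX : a \notin ground N :\: S by rewrite inE aS.
case: (unimodular_closure uN XE aE aX) => [[C [CN aC subC]]|[d [d0 da dC]]].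
  have [m [phi [/(_ C CN)[_ dC _ _] _]]] := uN.
  have taC : t a = (chi C a * (c C - \sum_(b | b != a) chi C b * (t b == 1)%:Z))%:~R.
    rewrite intrM [X in _ * X]rmorphB /= rmorph_sum /= -tc // (bigD1 a) //=.
    rewrite -addrA -sumrB big1 ?addr0 => [|b ba].
      by rewrite mulrA -rmorphM /= chi_sqr // mul1r.
    have [bC|] := boolP (b \in supp C); last first.
      by rewrite -chi_eq0 // => /eqP->; rewrite !mul0r subrr.
    rewrite rmorphM /= -tX ?subrr //.
    by have := subsetP subC b bC; rewrite !inE (negPf ba) => /andP[].
  move: aS; rewrite inE taC ltr0z ltrz1; lia.
pose P b := (b \in S) && (d b != 0).
have Pa : P a by rewrite /P aS da.
(* Ratio test: [r b] is the time at which coordinate [b], moving along [d], reaches 1 or 0. Stopping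
   at the smallest one keeps [t] in the cube and makes one more coordinate integral. *)
pose r b := if 0 < d b then (1 - t b) / d b else - t b / d b.
case: (arg_minP r Pa) => b0 /andP[b0S db0] minr.
have rP b : P b -> 0 < r b /\ t b + r b * d b = (0 < d b)%R%:R.
  case/andP; rewrite inE /r => /andP[tb0 tb1] db; case: ifP => dpos.
    by rewrite divfK // subrKC divr_gt0 ?subr_gt0.
  rewrite divfK // subrr; split=> //.
  have dneg : d b < 0 by rewrite lt_neqAle db leNgt dpos.
  by rewrite mulNr -mulrN -invrN divr_gt0 ?oppr_gt0.
have [r0 rb0] := rP b0 (introT andP (conj b0S db0)).
pose t' b := if b \in S then t b + r b0 * d b else t b.
have t'X b : b \notin S -> t' b = t b by rewrite /t' => /negPf->.
have t'01 b : 0 <= t' b <= 1.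
  have [bS|bS] := boolP (b \in S); last by rewrite t'X.
  rewrite /t' bS; have := bS; rewrite inE => /andP[tb0 tb1].
  have [->|db] := eqVneq (d b) 0; first by rewrite mulr0 addr0 !ltW.
  have Pb : P b by rewrite /P bS.
  have [rb0' rbE] := rP b Pb; have rle := minr b Pb.
  have [dpos|dneg] := ltP 0 (d b).
    have := ler_wpM2r (ltW dpos) rle; rewrite dpos mulr1n in rbE.
    have := mulr_gt0 r0 dpos; lra.
  have := ler_wnM2r dneg rle; rewrite ltNge dneg mulr0n in rbE.
  have := mulr_ge0_le0 (ltW r0) dneg; lra.
have t'S : [set a | 0 < t' a < 1] \proper S.
  apply/properP; split.
    apply/subsetP=> b; rewrite inE; apply: contraLR => bS; rewrite t'X //.
    by move: bS; rewrite inE.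
  exists b0; rewrite // inE /t' b0S rb0.
  by case: (0 < d b0); rewrite ltxx ?andbF.
have [|b bE||C CN|v [vc v0 v1]] := IHk t'.
- exact: leq_trans (proper_card t'S) tk.
- rewrite t'X ?t0 //; apply: contraNN bE; rewrite inE.
  by apply: contraTT => /t0->; rewrite ltxx.
- exact: t'01.
- have -> : (c C)%:~R = \sum_b (chi C b)%:~R * t b
                       + r b0 * (\sum_b (chi C b)%:~R * d b).
    by rewrite dC // mulr0 addr0 tc.
  rewrite mulr_sumr -big_split /=.
  have [m [phi [/(_ C CN)[subC disC _ _] _]]] := uN.
  apply: eq_bigr => b _; rewrite /t'; case: ifP => bS; first by ring.
  have [bE|bE] := boolP (b \in ground N).
    by rewrite d0 ?mulr0 ?addr0 // inE bS.
  have : chi C b == 0 by rewrite chi_eq0 //; apply: contra bE; apply/subsetP.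
  by move=> /eqP->; rewrite !mul0r mulr0 addr0.
exists v; split=> // b tb; [apply: v0|apply: v1]; rewrite t'X // inE tb ltxx //.
by rewrite andbF.
Qed.

(** * Polynomials on a parity class *)

Section ParityPolynomials.

Variable K : fieldType.
Hypothesis hK : [pchar K] =i pred0.

(** The value at 0 is left free: for q = 0 the opposite faces of the cube coincide. *)
Definition parity_poly (p : bool) (f : nat -> K) : Prop :=
  exists P : {poly K},
    forall q, (0 < q)%N -> odd q = p -> f q = P.[q%:R].

Lemma parity_poly_ext p f g :
  (forall q, (0 < q)%N -> f q = g q) -> parity_poly p f -> parity_poly p g.
Proof. by move=> fg [P fP]; exists P => q q0 qp; rewrite -fg // fP. Qed.

Lemma parity_poly_cst p (c : K) : parity_poly p (fun=> c).
Proof. by exists c%:P => q _ _; rewrite hornerC. Qed.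

Lemma parity_polyD p f g :
  parity_poly p f -> parity_poly p g -> parity_poly p (fun q => f q + g q).
Proof.
by move=> [P fP] [Q gQ]; exists (P + Q) => q q0 qp; rewrite hornerD fP ?gQ.
Qed.

Lemma parity_polyN p f : parity_poly p f -> parity_poly p (fun q => - f q).
Proof. by move=> [P fP]; exists (- P) => q q0 qp; rewrite hornerN fP. Qed.

Lemma parity_polyM p f g :
  parity_poly p f -> parity_poly p g -> parity_poly p (fun q => f q * g q).
Proof.
by move=> [P fP] [Q gQ]; exists (P * Q) => q q0 qp; rewrite hornerM fP ?gQ.
Qed.

Lemma parity_poly_sum (I : finType) (B : pred I) p (f : I -> nat -> K) :
  (forall i, B i -> parity_poly p (f i)) ->
  parity_poly p (fun q => \sum_(i | B i) f i q).
Proof.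
move=> fB.
have /fin_all_exists[P fP] i : exists P : {poly K}, B i ->
    forall q, (0 < q)%N -> odd q = p -> f i q = P.[q%:R].
  by have [/fB[P]|] := boolP (B i); [exists P|exists 0].
exists (\sum_(i | B i) P i) => q q0 qp; rewrite horner_sum.
by apply: eq_bigr => i Bi; apply: fP.
Qed.

Lemma parity_poly_succ p f :
  parity_poly (~~ p) f -> parity_poly p (fun q => f q.+1).
Proof.
move=> [P fP]; exists (P \Po ('X + 1)) => q q0 qp.
by rewrite fP //= ?qp // horner_comp hornerD hornerX hornerC -[1]/(1%:R) -natrD addn1.
Qed.

(** Isolates the leading term of the difference of a power. If E is the remainder for n, the next
    one is [('X + c%:P) * E] plus a multiple of ['X^n]. *)
Lemma size_binomial_remainder n (c : K) :
  (size (('X + c%:P) ^+ n.+1 - 'X ^+ n.+1 - (n.+1%:R * c) *: 'X^n)%R <= n)%N.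
Proof.
elim: n => [|n IHn].
  rewrite !expr1 expr0 mul1r alg_polyC.
  by rewrite [X in X - _]addrAC subrr add0r subrr size_poly0.
set E := (_ - _ - _) in IHn.
have -> : ('X + c%:P) ^+ n.+2 - 'X ^+ n.+2 - (n.+2%:R * c) *: 'X ^+ n.+1 =
    ('X + c%:P) * E + (n.+1%:R * c ^+ 2) *: 'X^n :> {poly K}.
  rewrite /E -!mul_polyC !polyCM !polyC_natr !exprS -![in LHS]natr1
    -![in RHS]natr1; ring.
rewrite (leq_trans (size_polyD _ _)) // geq_max; apply/andP; split.
  apply: leq_trans (size_polyMleq _ _) _; rewrite size_XaddC /=; exact: IHn.
by apply: leq_trans (size_scale_leq _ _) _; rewrite size_polyXn.
Qed.

(** The step 2 difference of ['X ^+ n.+1] has degree n and leading coefficient [n.+1%:R * 2],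
    nonzero in characteristic 0. A multiple of it cancels the leading term of [D], and the degree
    drops. *)
Lemma step2_antidifference (D : {poly K}) :
  exists P : {poly K}, forall x, P.[x + 2] - P.[x] = D.[x].
Proof.
have [k] := ubnP (size D); elim: k D => // k IHk D; rewrite ltnS => Dk.
have [D0|D0] := posnP (size D).
  by exists 0 => x; move/eqP: D0; rewrite size_poly_eq0 => /eqP->;
    rewrite !horner0 subrr.
have char0 n : n.+1%:R != 0 :> K by rewrite ((pcharf0P K).1 hK).
set n := (size D).-1; have sD : size D = n.+1 by rewrite prednK.
set e : K := lead_coef D / (n.+1%:R * 2).
have eE : e * (n.+1%:R * 2) = lead_coef D.
  by rewrite divfK // mulf_neq0 // (char0 1%N).
pose T : {poly K} := e *: (('X + 2%:P) ^+ n.+1 - 'X ^+ n.+1).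
have [|P PD] := IHk (D - T).
  apply: leq_trans Dk; rewrite sD ltnS.
  have -> : D - T = (D - lead_coef D *: 'X^n)
      - e *: (('X + 2%:P) ^+ n.+1 - 'X ^+ n.+1 - (n.+1%:R * 2) *: 'X^n).
    by rewrite /T [in RHS]scalerBr scalerA eE opprB addrA subrK.
  rewrite (leq_trans (size_polyD _ _)) // geq_max size_polyN; apply/andP; split.
    apply/leq_sizeP => j; rewrite leq_eqVlt => /orP[/eqP<-|nj].
      by rewrite coefB coefZ coefXn eqxx mulr1 /lead_coef subrr.
    rewrite coefB coefZ coefXn gtn_eqF // mulr0 subr0.
    by move/leq_sizeP: (leqnn (size D)); apply; rewrite sD.
  by apply: leq_trans (size_scale_leq _ _) _; apply: size_binomial_remainder.
exists (P + e *: 'X ^+ n.+1) => x.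
rewrite !hornerE /= -[D.[x]](subrK T.[x]) -hornerN -hornerD -PD /T !hornerE /=; ring.
Qed.

Lemma parity_poly_recur p f (g : nat -> K) :
  parity_poly p g -> (forall q, (0 < q)%N -> odd q = p -> f q.+2 = f q + g q) ->
  parity_poly p f.
Proof.
move=> [D gD] fg; have [P PD] := step2_antidifference D.
(* [q0] is the least positive integer of parity [p]: 1 or 2. *)
pose q0 := (~~ p).+1; exists (P + (f q0 - P.[q0%:R])%:P) => q q_gt0 qp.
have -> : q = (q0 + (q - q0)./2.*2)%N.
  move: q_gt0 qp; rewrite /q0; case: p {fg gD q0} => /=; lia.
elim: (_./2) => [|k IHk]; first by rewrite addn0 hornerD hornerC addrC subrK.
rewrite doubleS !addnS fg; last 2 first.
- by rewrite /q0 addSn.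
- by rewrite oddD odd_double addbF /q0 /=; case: (p).
rewrite IHk gD; last 2 first.
- by rewrite /q0 addSn.
- by rewrite oddD odd_double addbF /q0 /=; case: (p).
have -> : (q0 + k.*2).+2%:R = (q0 + k.*2)%:R + 2 :> K by rewrite -addn2 natrD.
rewrite -PD !hornerD !hornerC; ring.
Qed.

End ParityPolynomials.

(** * Lattice points in cubes *)

Section LatticePoints.

Variables (V I : finType) (x : I -> V -> int) (c : I -> int).

(** These are points of the q-th dilate of a polytope cut out of the unit cube by the equations with
    right-hand sides [c], as in Ehrhart theory, but with prescribed parities. *)
Definition lattice_points (w : {ffun V -> bool}) (q : nat) :
    {set {ffun V -> 'I_q.+1}} :=
  [set y : {ffun V -> 'I_q.+1} | [forall a, odd (y a) == w a]
     & [forall i, \sum_a x i a * (y a : nat)%:Z == q%:Z * c i]].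

(* Faces of the cube [0, q]^V: [None] marks a free coordinate. *)
Definition face_of (q : nat) (y : {ffun V -> 'I_q.+1}) :
    {ffun V -> option bool} :=
  [ffun a => if y a == 0 :> nat then Some false
             else if y a == q :> nat then Some true else None].

(** The second argument is the smaller face: it fixes every coordinate that the first one fixes, to
    the same value. *)
Definition subface (rho rho' : {ffun V -> option bool}) : bool :=
  [forall a, (rho a == None) || (rho' a == rho a)].

Definition closed_count rho w q :=
  #|[set y in lattice_points w q | subface rho (face_of y)]|.

Definition open_count rho w q :=
  #|[set y in lattice_points w q | face_of y == rho]|.

Lemma count_by_face (B : pred {ffun V -> option bool}) w q :
  #|[set y in lattice_points w q | B (face_of y)]| =
  (\sum_(rho | B rho) open_count rho w q)%N.
Proof.
rewrite -sum1_card (partition_big (@face_of q) B) /=; last first.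
  by move=> y; rewrite inE => /andP[].
apply: eq_bigr => rho Brho; rewrite /open_count -sum1_card; apply: eq_bigl => y.
by rewrite !inE -andbA; congr (_ && _); case: eqP => [->|]; rewrite ?andbF ?Brho.
Qed.

(* y |-> y + v is a bijection from degree q onto the points of degree q + 1 that
   lie on no face of the cube opposite to v. *)
Lemma closed_count_succ (rho : {ffun V -> option bool}) (w v : {ffun V -> bool}) q :
  (0 < q)%N -> (forall i, \sum_a x i a * (v a : nat)%:Z = c i) ->
  (forall a b, rho a = Some b -> v a = b) ->
  closed_count rho w q.+1 =
  (closed_count rho [ffun a => w a (+) v a] q +
   \sum_(rho' | subface rho rho' && [exists a, rho' a == Some (~~ v a)])
      open_count rho' w q.+1)%N.
Proof.
move=> q0 xv rhov; rewrite -count_by_face /closed_count.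
pose opp (y : {ffun V -> 'I_q.+2}) := [exists a, face_of y a == Some (~~ v a)].
rewrite -(cardsID [set y | ~~ opp y]) -!setIdE.
congr (_ + _)%N; last first.
  by apply: eq_card => y; rewrite !inE negbK -andbA; do 2!bool_congr; rewrite andbC.
pose h (y : {ffun V -> 'I_q.+1}) : {ffun V -> 'I_q.+2} :=
  [ffun a => inord (y a + v a)].
have hE y a : h y a = (y a + v a)%N :> nat.
  rewrite ffunE inordK //; have := ltn_ord (y a); case: (v a); lia.
have h_inj : injective h.
  move=> y y' hyy'; apply/ffunP=> a; apply: val_inj => /=.
  by have := hE y a; rewrite hyy' hE => /addIn.
(* After translation a coordinate is on the boundary only on the side that [v a] points to, and only
   if it was there before. *)
have faceh y a : face_of (h y) a =
    if face_of y a == Some (v a) then Some (v a) else None.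
  rewrite [LHS]ffunE hE [face_of y a]ffunE.
  move: (ltn_ord (y a)); move: (nat_of_ord (y a)) => n nq.
  case: (v a); rewrite ?addn0 ?addn1 ?eqSS /=; case: (n =P 0) => n0;
    case: (n =P q) => nq' //=; try lia;
    by have -> : (n == q.+1) = false by lia.
have memh : forall u, (h u \in [set z in [set t in lattice_points w q.+1 |
      subface rho (face_of t)] | ~~ opp z]) =
    (u \in [set t in lattice_points [ffun a => w a (+) v a] q |
      subface rho (face_of t)]).
  move=> y; rewrite !inE; have -> : ~~ opp (h y).
    rewrite negb_exists; apply/forallP => a; rewrite faceh.
    by case: ifP => // _; case: (v a).
  rewrite andbT; congr (_ && _ && _); apply: eq_forallb => i.
  - by rewrite hE oddD ffunE oddb; case: (odd _); case: (v i); case: (w i).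
  - have -> : q.+1%:Z * c i = q%:Z * c i + \sum_a x i a * (v a : nat)%:Z.
      by rewrite xv intS mulrDl mul1r addrC.
    under eq_bigr do rewrite hE PoszD mulrDr.
    by rewrite big_split /= (inj_eq (addIr _)).
  - rewrite faceh; case E: (rho i) => [b|] //; rewrite (rhov _ _ E).
    by case: (face_of y i == Some b); rewrite ?eqxx.
rewrite -(card_imset _ h_inj); apply: eq_card => z; apply/idP/imsetP.
  move=> zL; have := zL; rewrite inE => /andP[_ zopp].
  have zv a : (v a <= z a)%N && (z a - v a <= q)%N.
    move: zopp; rewrite negb_exists => /forallP/(_ a); rewrite ffunE.
    have := ltn_ord (z a).
    case: (v a); case: (eqVneq (z a : nat) 0); case: (eqVneq (z a : nat) q.+1);
      rewrite /= ?eqxx //; lia.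
  pose y : {ffun V -> 'I_q.+1} := [ffun a => inord (z a - v a)].
  have hy : z = h y.
    apply/ffunP=> a; apply: val_inj; rewrite /= hE ffunE.
    by have /andP[va zaq] := zv a; rewrite inordK // subnK.
  by exists y; rewrite -?memh -?hy.
by case=> y yL ->; rewrite memh.
Qed.

(** [Z] will be the complement of the ground set, where coflows are extended by zero. *)
Variables (K : fieldType) (Z : {set V}).
Hypothesis hK : [pchar K] =i pred0.
Hypothesis integral_vertex : forall q (y : {ffun V -> 'I_q.+1}), (0 < q)%N ->
  {in Z, forall a, y a = 0 :> nat} ->
  (forall i, \sum_a x i a * (y a : nat)%:Z = q%:Z * c i) ->
  exists v : {ffun V -> bool}, (forall i, \sum_a x i a * (v a : nat)%:Z = c i) /\
    forall a b, face_of y a = Some b -> v a = b.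

(* By the previous lemma, applied twice, the closed count of a face has second
   differences given by open counts of smaller faces. If the polytope has no
   vertex on the face, it has no point there at all. *)
Lemma lattice_count_parity_poly (rho : {ffun V -> option bool}) :
  {in Z, forall a, rho a = Some false} -> forall w p,
  parity_poly p (fun q => (closed_count rho w q)%:R : K) /\
  parity_poly p (fun q => (open_count rho w q)%:R : K).
Proof.
have [k] := ubnP #|[set a | rho a == None]|.
elim: k rho => // k IHk rho; rewrite ltnS => rhok rhoZ w0 p0.
have smaller rho' : subface rho rho' ->
    (exists a, rho a = None /\ rho' a <> None) -> forall w p,
    parity_poly p (fun q => (open_count rho' w q)%:R : K).
  move=> /forallP sub [a [rhoa rho'a]] w p.
  have [||_ //] := IHk rho' _ _ w p.
    apply: leq_trans rhok; apply: proper_card; apply/properP; split.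
      apply/subsetP=> b; rewrite !inE => /eqP rho'b.
      by have := sub b; rewrite rho'b eq_sym orbb.
    by exists a; rewrite !inE ?rhoa //; apply/eqP.
  by move=> b bZ; have := sub b; rewrite rhoZ //= => /eqP.
have closedP w p : parity_poly p (fun q => (closed_count rho w q)%:R : K).
  case: (classic (exists v : {ffun V -> bool},
      (forall i, \sum_a x i a * (v a : nat)%:Z = c i) /\
      (forall a b, rho a = Some b -> v a = b))) => [[v [xv rhov]]|nv].
    pose w' := [ffun a => w a (+) v a].
    pose B rho' := subface rho rho' && [exists a, rho' a == Some (~~ v a)].
    pose D w q : K := \sum_(rho' | B rho') (open_count rho' w q)%:R.
    have DP u r : parity_poly r (D u).
      apply: parity_poly_sum => rho' /andP[sub /existsP[a /eqP rho'a]].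
      apply: smaller => //; exists a; split; last by rewrite rho'a.
      have /forallP/(_ a) := sub; case E: (rho a) => [b|] //=.
      by rewrite rho'a (rhov _ _ E) => /eqP[]; case: (b).
    have GD u q : (0 < q)%N -> (closed_count rho u q.+1)%:R =
        (closed_count rho [ffun a => u a (+) v a] q)%:R + D u q.+1 :> K.
      by move=> q0; rewrite (closed_count_succ _ q0 xv rhov) natrD natr_sum.
    apply: (parity_poly_recur hK (g := fun q => D w' q.+1 + D w q.+2)).
      apply: parity_polyD; first exact: parity_poly_succ.
      by apply: (parity_poly_succ (f := fun q => D w q.+1)); apply: parity_poly_succ.
    move=> q q0 _; rewrite !GD // -addrA; congr (_%:R + _).
    (* The two translations by [v] cancel in the parities. *)
    by congr closed_count; apply/ffunP=> a; rewrite !ffunE addbK.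
  apply: (parity_poly_ext (f := fun=> 0)); last exact: parity_poly_cst.
  move=> q q0; rewrite [X in X%:R]eq_card0 // => y; apply/negP.
  rewrite !inE => /andP[/andP[_ /forallP yc] /forallP sub]; apply: nv.
  have rhoy a b : rho a = Some b -> face_of y a = Some b.
    by move=> E; have := sub a; rewrite E /= => /eqP.
  have [||v [xv yv]] := integral_vertex (y := y) q0.
  - move=> a /rhoZ/rhoy; rewrite ffunE; case: eqP => // _.
    by case: eqP.
  - by move=> i; apply/eqP.
  by exists v; split=> // a b /rhoy/yv.
split; first exact: closedP.
(* A closed face is the disjoint union of the relative interiors of its subfaces. *)
apply: (parity_poly_ext (f := fun q => (closed_count rho w0 q)%:R
   - \sum_(rho' | subface rho rho' && (rho' != rho)) (open_count rho' w0 q)%:R)).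
  move=> q _; have subrho : subface rho rho.
    by apply/forallP=> a; rewrite eqxx orbT.
  rewrite /closed_count (count_by_face (subface rho)) (bigD1 rho) //=.
  by rewrite natrD natr_sum addrK.
apply: parity_polyD => //; apply: parity_polyN; apply: parity_poly_sum => rho'.
move=> /andP[sub neq]; apply: smaller => //.
have [a rhoa] : exists a, rho' a != rho a.
  by apply/existsP; apply: contraNT neq => /existsPn eqrho;
    apply/eqP/ffunP => a; apply/eqP; rewrite -[_ == _]negbK eqrho.
exists a; have /forallP/(_ a) := sub; rewrite (negPf rhoa) orbF => /eqP E.
by split=> //; move/eqP: rhoa; rewrite E.
Qed.

End LatticePoints.

(** * Sign patterns of coflows *)

Definition integral_coflow (V : finType) (N : signed_system V) (q : nat)
    (f : V -> int) : bool :=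
  [forall C in circuits N, (q%:Z %| \sum_a chi C a * f a)%Z].

(** Functions on all of [V] vanishing off the ground set: coflows of all minors then have the same
    type, unlike [residue_map], whose domain depends on [N]. *)
Definition coflows (V : finType) (N : signed_system V) (q : nat) :
    {set {ffun V -> 'I_q}} :=
  [set f : {ffun V -> 'I_q} | [forall a, (a \notin ground N) ==> (f a == 0 :> nat)]
     & integral_coflow N q (fun a => (f a : nat)%:Z)].

(* For odd q the values [Some true] and [Some false] stand for f^> and f^<. *)
Definition residue_sign (q k : nat) : option bool :=
  if k == 0 then None else Some (k <= q./2)%N.

Definition pattern (V : finType) (q : nat) (f : {ffun V -> 'I_q}) :
    {ffun V -> option bool} := [ffun a => residue_sign q (f a)].

(** Made total on pairs of sets, so that these pairs can index the equations; a pair that is not a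
    circuit contributes a zero row. *)
Definition circuit_vector (V : finType) (N : signed_system V)
    (C : {set V} * {set V}) (a : V) : int :=
  if C \in circuits N then chi C a else 0.

(** Rounding is applied to the point [y / q] of the unit cube; coordinates equal to 0 or q become 0
    or 1, which rounding preserves. *)
Lemma unimodular_vertex (F : realFieldType) (V : finType)
    (N : signed_system V) (c : {set V} * {set V} -> int) q
    (y : {ffun V -> 'I_q.+1}) :
  unimodular F N -> (0 < q)%N ->
  {in ~: ground N, forall a, y a = 0 :> nat} ->
  (forall C, \sum_a circuit_vector N C a * (y a : nat)%:Z = q%:Z * c C) ->
  exists v : {ffun V -> bool},
    (forall C, \sum_a circuit_vector N C a * (v a : nat)%:Z = c C) /\
    forall a b, face_of y a = Some b -> v a = b.
Proof.
move=> uN q0 yE yc.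
have qF : q%:R != 0 :> F by rewrite pnatr_eq0 -lt0n.
have [||C CN|v [vc v0 v1]] := unimodular_rounding
    (c := c) (t := fun a => (y a)%:R / q%:R :> F) uN.
- by move=> a aE; rewrite yE ?inE // mul0r.
- move=> a; rewrite divr_ge0 ?ler0n //= ler_pdivrMr ?ltr0n // mul1r ler_nat.
  by rewrite -ltnS.
- apply: (mulIf qF); rewrite mulr_suml.
  have := congr1 (fun z : int => z%:~R : F) (yc C).
  rewrite rmorph_sum /= intrM mulrC => <-; apply: eq_bigr => a _.
  by rewrite /circuit_vector CN intrM mulrA mulfVK.
exists [ffun a => v a]; split=> [C|a b].
  have [CN|CN] := boolP (C \in circuits N).
    by rewrite -vc //; apply: eq_bigr => a _; rewrite /circuit_vector CN ffunE.
  have vec0 (g : V -> int) : \sum_a circuit_vector N C a * g a = 0.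
    by rewrite big1 // => a _; rewrite /circuit_vector (negPf CN) mul0r.
  (* For a zero row the equation satisfied by [y] forces [c C = 0], as q is positive. *)
  rewrite vec0; have /esym/eqP := yc C; rewrite vec0 mulf_eq0 => /orP[|/eqP //].
  by rewrite eqz_nat eqn0Ngt q0.
rewrite !ffunE; case: eqP => [ya [<-]|_]; first by apply: v0; rewrite ya mul0r.
by case: eqP => // ya [<-]; apply: v1; rewrite ya divff.
Qed.

Lemma dvdz_sum_congr (V : finType) (q : int) (u f g : V -> int) :
  (forall a, q %| f a - g a)%Z ->
  (q %| \sum_a u a * f a)%Z = (q %| \sum_a u a * g a)%Z.
Proof.
move=> fg; have -> : \sum_a u a * f a =
    \sum_a u a * g a + \sum_a u a * (f a - g a).
  by rewrite -big_split; apply: eq_bigr => a _ /=; rewrite -mulrDr subrKC.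
by rewrite rpredDr //; apply: rpred_sum => a _; apply: dvdz_mull.
Qed.

Lemma dvdz_modn_sub q m : (q%:Z %| (m %% q)%N%:Z - m%:Z)%Z.
Proof.
by rewrite -opprB rpredN {1}(divn_eq m q) PoszD addrK PoszM dvdz_mull.
Qed.

Lemma double_modn q k : odd q -> (k < q)%N ->
  (k.*2 %% q)%N = (if (k <= q./2)%N then k.*2 else k.*2 - q)%N.
Proof.
move=> qodd kq; case: ifP => kh; first by rewrite modn_small //; lia.
have -> : k.*2 = (k.*2 - q + q)%N by lia.
rewrite modnDr modn_small; lia.
Qed.

(** In the lower half [k.*2] is already reduced and even; in the upper half the reduction subtracts
    the odd [q] once. *)
Lemma residue_sign_double q k : odd q -> (k < q)%N ->
  ((k.*2 %% q == 0)%N = (residue_sign q k == None)) *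
  (odd (k.*2 %% q)%N = (residue_sign q k == Some false)).
Proof.
move=> qodd kq; rewrite double_modn // /residue_sign.
case: (k =P 0) => [->|k0] //=.
have -> : ((if k <= q./2 then k.*2 else k.*2 - q) == 0)%N = false.
  by case: ifP; lia.
have -> : odd (if k <= q./2 then k.*2 else k.*2 - q)%N = ~~ (k <= q./2)%N.
  by case: ifP => kh; rewrite ?odd_double // oddB ?odd_double ?qodd //; lia.
by case: (k <= q./2)%N.
Qed.

(* The coflow f is replaced by y = 2 f mod q in [0, q): residues in (0, q/2)
   become the nonzero even coordinates of y and those in (q/2, q) the odd ones,
   so that sign patterns turn into parities. The sum is over the possible
   quotients of the circuit sums of y by q, shifted by #|V| to be nonnegative. *)
Lemma card_pattern (V : finType) (N : signed_system V) q
    (sigma : {ffun V -> option bool}) :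
  odd q -> (forall a, a \notin ground N -> sigma a = None) ->
  #|[set f in coflows N q | pattern f == sigma]| =
  (\sum_(c : {ffun {set V} * {set V} -> 'I_(#|V|.*2.+1)})
     open_count (circuit_vector N) (fun C => (c C : nat)%:Z - #|V|%:Z)%R
       [ffun a => if sigma a is None then Some false else None]
       [ffun a => sigma a == Some false] q)%N.
Proof.
move=> qodd sigmaE; have q0 : (0 < q)%N by case: q qodd.
set rho := [ffun a => if sigma a is None then Some false else None].
set w := [ffun a => sigma a == Some false].
pose h (f : {ffun V -> 'I_q}) : {ffun V -> 'I_q.+1} :=
  [ffun a => inord ((f a).*2 %% q)%N].
have hE f a : h f a = ((f a).*2 %% q)%N :> nat.
  by rewrite ffunE inordK // ltnS ltnW // ltn_pmod.
have signE (f : {ffun V -> 'I_q}) a := residue_sign_double qodd (ltn_ord (f a)).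
have faceE f a : face_of (h f) a =
    if residue_sign q (f a) is None then Some false else None.
  rewrite ffunE hE (signE f a).1; case: (residue_sign q (f a)) => //= b.
  by rewrite ltn_eqF // ltn_pmod.
have rhoE a : rho a = if sigma a is None then Some false else None.
  by rewrite ffunE.
have h_inj : injective h.
  move=> f f' hff'; apply/ffunP=> a; apply: val_inj => /=.
  have := hE f a; rewrite hff' hE !double_modn //.
  have := ltn_ord (f a); have := ltn_ord (f' a); do 2 case: ifP; lia.
(* Doubling preserves the coflow condition in both directions because 2 is invertible modulo the odd
   [q]. *)
have dvdE f C : (q%:Z %| \sum_a circuit_vector N C a * (h f a : nat)%:Z)%Z =
    (q%:Z %| \sum_a circuit_vector N C a * (f a : nat)%:Z)%Z.
  rewrite (dvdz_sum_congr _ (g := fun a => 2 * (f a : nat)%:Z)) => [|a].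
    under eq_bigr do rewrite mulrCA.
    by rewrite -mulr_sumr Gauss_dvdzr // coprimezE coprimen2.
  by rewrite hE -[2]/(2%:Z) -PoszM mul2n dvdz_modn_sub.
pose Y := [set y : {ffun V -> 'I_q.+1} |
  [&& [forall a, odd (y a) == w a], face_of y == rho
    & [forall C, (q%:Z %| \sum_a circuit_vector N C a * (y a : nat)%:Z)%Z]]].
have hY f : (h f \in Y) = (f \in [set f in coflows N q | pattern f == sigma]).
  rewrite !inE; apply/and3P/andP => [[/forallP hw /eqP hrho /forallP hC]|].
    have fsigma : pattern f = sigma.
      apply/ffunP=> a; rewrite ffunE.
      have := congr1 (fun r : {ffun _} => r a) hrho; rewrite faceE rhoE.
      have := hw a; rewrite hE (signE f a).2 ffunE.
      by case: (residue_sign _ _) => [[]|]; case: (sigma a) => [[]|].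
    split; last by rewrite fsigma.
    apply/andP; split.
      apply/forallP=> a; apply/implyP => /sigmaE sa.
      have := congr1 (fun r : {ffun _} => r a) fsigma; rewrite ffunE sa.
      by rewrite /residue_sign; case: eqP.
    apply/forall_inP => C CN; have := hC C; rewrite dvdE.
    by congr (_ %| _)%Z; apply: eq_bigr => a _; rewrite /circuit_vector CN.
  move=> [/andP[/forallP fE /forall_inP fC] /eqP fsigma].
  have sE a : residue_sign q (f a) = sigma a by rewrite -fsigma ffunE.
  split.
  - by apply/forallP=> a; rewrite hE (signE f a).2 ffunE sE.
  - by apply/eqP/ffunP=> a; rewrite faceE rhoE sE.
  - apply/forallP=> C; rewrite dvdE; have [CN|CN] := boolP (C \in circuits N).
      have := fC C CN.
      by congr (_ %| _)%Z; apply: eq_bigr => a _; rewrite /circuit_vector CN.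
    by rewrite big1 ?dvdz0 // => a _; rewrite /circuit_vector (negPf CN) mul0r.
rewrite -(card_imset _ h_inj).
have -> : h @: [set f in coflows N q | pattern f == sigma] = Y.
  apply/setP=> y; apply/imsetP/idP => [[f fL ->]|yY]; first by rewrite hY.
  (* [rho] never takes the value [Some true], which excludes [y a = q]. *)
  have yq a : (y a < q)%N.
    have := yY; rewrite inE => /and3P[_ /eqP yrho _].
    have := congr1 (fun r : {ffun _} => r a) yrho; rewrite !ffunE.
    have := ltn_ord (y a); rewrite ltnS leq_eqVlt => /orP[/eqP ->|//].
    by rewrite eqxx [q == 0]eqn0Ngt q0; case: (sigma a).
  (* Halving modulo [q]: an odd value becomes even by adding [q]. *)
  pose e a := if odd (y a) then (y a + q)./2 else (y a)./2.
  have eq a : (e a < q)%N by rewrite /e; have := yq a; case: ifP; lia.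
  pose f : {ffun V -> 'I_q} := [ffun a => Ordinal (eq a)].
  have yh : y = h f.
    apply/ffunP=> a; apply: val_inj; rewrite /= hE double_modn ?ltn_ord // ffunE /=.
    rewrite /e; have := yq a; have := odd_double_half (y a).
    have := odd_double_half (y a + q); have := odd_double_half q.
    rewrite oddD qodd; case: (odd (y a)) => /=; case: ifP; lia.
  by exists f; rewrite -?hY -?yh.
pose dot (y : {ffun V -> 'I_q.+1}) C : int :=
  \sum_a circuit_vector N C a * (y a : nat)%:Z.
(* Circuit entries are -1, 0 or 1 and coordinates are at most q, so the quotients lie between
   [-#|V|] and [#|V|]; this explains the [#|V|.*2.+1] possible values. *)
have dot_bound y C : `|dot y C| <= #|V|%:Z * q%:Z.
  apply: le_trans (ler_norm_sum _ _ _) _.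
  have -> : #|V|%:Z * q%:Z = \sum_(a : V) q%:Z.
    by rewrite sumr_const -mulr_natl natz.
  apply: ler_sum => a _; rewrite normrM -[q%:Z]mul1r; apply: ler_pM => //.
    by rewrite /circuit_vector /chi; case: ifP => // _; do 2 case: (_ \in _).
  by rewrite ger0_norm // lez_nat -ltnS ltn_ord.
pose quo y : {ffun {set V} * {set V} -> 'I_(#|V|.*2.+1)} :=
  [ffun C => inord (absz ((dot y C %/ q%:Z)%Z + #|V|%:Z))].
have qZ : 0 < q%:Z by [].
rewrite -sum1_card (partition_big quo predT) //=; apply: eq_bigr => c _.
rewrite sum1_card; apply: eq_card => y; rewrite unfold_in !inE -!andbA.
congr (_ && _); rewrite [RHS]andbC; congr (_ && _).
apply/andP/forallP => [[/forallP dvdC /eqP <-] C|dotC].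
  have := dvdC C; rewrite -/(dot y C) dvdz_eq => /eqP dotE.
  have := dot_bound y C; rewrite -dotE normrM [`|q%:Z|]gtr0_norm // ler_pM2r //.
  rewrite ler_norml => /andP[lo up].
  rewrite ffunE; move: (dot y C %/ q%:Z)%Z lo up => k lo up.
  have k0 : 0 <= k + #|V|%:Z by rewrite -lerBlDr sub0r.
  rewrite inordK; first by rewrite gez0_abs // addrK mulrC.
  rewrite ltnS -lez_nat gez0_abs // -addnn PoszD lerD2r //.
have quoE C : (dot y C %/ q%:Z)%Z = (c C : nat)%:Z - #|V|%:Z.
  by have /eqP := dotC C; rewrite -/(dot y C) => ->; rewrite mulKz ?gt_eqF.
split.
  by apply/forallP=> C; have /eqP-> := dotC C; apply: dvdz_mulr.
apply/eqP/ffunP=> C; apply: val_inj; rewrite ffunE quoE subrK /=.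
by rewrite inordK ?ltn_ord.
Qed.

Lemma card_pattern_parity_poly (F : realFieldType) (K : fieldType)
    (V : finType) (N : signed_system V) (sigma : {ffun V -> option bool}) :
  [pchar K] =i pred0 -> unimodular F N ->
  (forall a, a \notin ground N -> sigma a = None) ->
  parity_poly true (fun q =>
    #|[set f in coflows N q | pattern f == sigma]|%:R : K).
Proof.
move=> hK uN sigmaE.
pose c (k : {ffun {set V} * {set V} -> 'I_(#|V|.*2.+1)}) C : int :=
  (k C : nat)%:Z - #|V|%:Z.
pose rho := [ffun a => if sigma a is None then Some false else None].
have [P PE] : parity_poly true (fun q => \sum_k
    (open_count (circuit_vector N) (c k) rho [ffun a => sigma a == Some false] q)%:R : K).
  apply: parity_poly_sum => k _.
  apply: (proj2 (@lattice_count_parity_poly _ _ (circuit_vector N) (c k) K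
     (~: ground N) hK _ rho _ _ _)) => [q y q0|a].
    exact: (unimodular_vertex uN q0).
  by rewrite inE ffunE => /sigmaE->.
by exists P => q q0 qodd; rewrite -PE // card_pattern // natr_sum.
Qed.

(** * Coflows of minors *)

Section IntegerDependencies.

Variables (F : realFieldType) (V : finType) (N : signed_system V) (m : nat).
Variable phi : V -> 'rV[F]_m.
Hypothesis phiN : vector_matroid N phi.

Definition dependency (x : V -> int) : Prop :=
  (forall a, a \notin ground N -> x a = 0) /\
  \sum_a (x a)%:~R *: phi a = 0.

Lemma circuit_dependency C : C \in circuits N -> dependency (chi C).
Proof.
move=> CN; have [subC disC depC _] := phiN.1 C CN; split=> // a aE.
by apply/eqP; rewrite chi_eq0 //; apply: contra aE; apply/subsetP.
Qed.

Lemma dependency_circuit x a : dependency x -> x a != 0 ->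
  exists C, [/\ C \in circuits N, a \in supp C
    & forall b, b \in supp C -> x b != 0].
Proof.
move=> [x0 xdep] xa.
have [|//||C [CN aC subC]] := phiN.2 (fun a => (x a)%:~R) _ _ a.
- by move=> b /x0->.
- by rewrite intr_eq0.
by exists C; split=> // b /subC; rewrite intr_eq0.
Qed.

(* Subtracting multiples of circuits from a dependency clears its coordinates
   outside Q one at a time. *)
Lemma dependency_dvdz (q : int) (f : V -> int) (Q : {set V}) :
  (forall x, dependency x -> (forall a, a \notin Q -> x a = 0) ->
     (q %| \sum_a x a * f a)%Z) ->
  (forall x a, dependency x -> a \notin Q -> x a != 0 ->
     exists C, [/\ C \in circuits N, (q %| \sum_a chi C a * f a)%Z,
       exists2 b, b \in supp C & b \notin Q
       & forall b, b \in supp C -> b \notin Q -> x b != 0]) ->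
  forall x, dependency x -> (q %| \sum_a x a * f a)%Z.
Proof.
move=> base step x; have [k] := ubnP #|[set a | (a \notin Q) && (x a != 0)]|.
elim: k x => // k IHk x; rewrite ltnS => xk xdep.
have [x0|[a]] := set_0Vmem [set a | (a \notin Q) && (x a != 0)].
  apply: base => // a aQ; apply/eqP/negPn/negP => xa.
  by have := in_set0 a; rewrite -x0 inE aQ xa.
rewrite inE => /andP[aQ xa].
have [C [CN qC [b bC bQ] subC]] := step x a xdep aQ xa.
have [_ disC _ _] := phiN.1 C CN.
(* Since [chi C b] squares to 1, this integer multiple of the circuit clears exactly coordinate
   [b]. *)
pose x' e := x e - x b * chi C b * chi C e.
have -> : \sum_e x e * f e =
    \sum_e x' e * f e + x b * chi C b * \sum_e chi C e * f e.
  by rewrite mulr_sumr -big_split; apply: eq_bigr => e _; rewrite /x' /=; ring.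
rewrite rpredD ?dvdz_mull //; apply: IHk.
  apply: leq_trans xk; apply: proper_card; apply/properP; split.
    apply/subsetP=> e; rewrite !inE => /andP[eQ]; rewrite eQ /x'.
    have [/subC->//|] := boolP (e \in supp C).
    by rewrite -chi_eq0 // => /eqP->; rewrite mulr0 subr0.
  exists b; first by rewrite inE bQ subC.
  by rewrite inE /x' -mulrA chi_sqr // mulr1 subrr eqxx andbF.
have [Cgr Cdep] := circuit_dependency CN; have [x0 xdep0] := xdep.
split=> [e eE|]; first by rewrite /x' (x0 e) // (Cgr e) // mulr0 subr0.
under eq_bigr => e _.
  rewrite /x' rmorphB /= intrM scalerBl -scalerA; over.
by rewrite sumrB -scaler_sumr xdep0 Cdep scaler0 subr0.
Qed.

(** As [f] vanishes on [R], a circuit and its trace have the same sum. Traces of circuits of [N]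
    need not be minimal, so the converse reduces an arbitrary circuit by those with minimal
    trace. *)
Lemma contraction_coflow (R : {set V}) (q : nat) (f : V -> int) :
  {in R, forall a, f a = 0} ->
  integral_coflow (contraction R N) q f = integral_coflow N q f.
Proof.
move=> fR.
have chiR C a : chi (restrict_signed R C) a = if a \in R then 0 else chi C a.
  by rewrite /chi !inE; case: (a \in R).
have suppR C : supp (restrict_signed R C) = supp C :\: R.
  by rewrite /supp /= setDUl.
have sumR C : \sum_a chi (restrict_signed R C) a * f a = \sum_a chi C a * f a.
  apply: eq_bigr => a _; rewrite chiR; case: ifP => // aR.
  by rewrite fR // !mulr0.
apply/forall_inP/forall_inP => [cofl C CN|cofl D]; last first.
  by rewrite !inE => /andP[/andP[/imsetP[C CN ->] _] _]; rewrite sumR cofl.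
apply: (dependency_dvdz (Q := R)) (circuit_dependency CN) => {C CN}.
  move=> x _ xR; rewrite big1 ?dvdz0 // => a _.
  by have [/fR->|/xR->] := boolP (a \in R); rewrite ?mulr0 ?mul0r.
move=> x a xdep aR xa.
have [C0 [C0N aC0 sub0]] := dependency_circuit xdep xa.
(* Among circuits whose nonempty trace lies inside that of [C0], one with the smallest trace gives a
   circuit of the contraction. *)
pose P C := (C \in circuits N) && (supp C :\: R != set0)
  && (supp C :\: R \subset supp C0 :\: R).
have PC0 : P C0.
  by rewrite /P C0N subxx andbT; apply/set0Pn; exists a; rewrite inE aR.
case: (arg_minnP (fun C => #|supp C :\: R|) PC0) => C.
move=> /andP[/andP[CN nC] sC] minC; exists C; split=> //.
- rewrite -sumR; apply: cofl; rewrite !inE suppR nC andbT imset_f //=.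
  apply/forall_inP => D; rewrite !inE => /andP[/imsetP[C' C'N ->]].
  rewrite !suppR => nC'; apply/implyP => sC'.
  by rewrite eqEcard sC' minC // /P C'N nC' (subset_trans sC').
- by have [b] := set0Pn _ nC; rewrite inE => /andP[bR bC]; exists b.
- move=> b bC bR; apply: sub0.
  by have := subsetP sC b; rewrite !in_setD bR bC => /(_ isT).
Qed.

End IntegerDependencies.

(** * Bases, and the fibres of the restriction of coflows to a deletion *)

Section Bases.

Variables (F : realFieldType) (V : finType).
Implicit Types (N : signed_system V) (I R : {set V}).

Lemma integral_coflow_congr N q (f g : V -> int) :
  (forall a, q%:Z %| f a - g a)%Z ->
  integral_coflow N q f = integral_coflow N q g.
Proof.
by move=> fg; apply: eq_forallb => C; congr (_ ==> _); apply: dvdz_sum_congr.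
Qed.

Lemma fundamental_circuit N I a :
  maxset (independent N) I -> a \in ground N -> a \notin I ->
  exists C, [/\ C \in circuits N, a \in supp C & supp C \subset a |: I].
Proof.
move=> /maxsetP[/andP[subI indI] maxI] aE aI.
have : ~~ independent N (a |: I).
  by apply: contra aI => /maxI <-; rewrite ?subsetUr ?setU11.
rewrite negb_and subUset sub1set aE subI /=.
case/forall_inPn => C CN; rewrite negbK => sC; exists C; split=> //.
apply: contraLR (forall_inP indI C CN) => aC; rewrite negbK.
apply/subsetP=> b bC; have := subsetP sC b bC; rewrite !inE => /orP[/eqP ba|//].
by rewrite ba (negPf aC) in bC.
Qed.

(** Values on a basis can be chosen freely: each other value is dictated by a fundamental circuit,
    and these circuits generate all relations. *)
Lemma coflow_extension N I n (g : V -> 'I_n.+1) :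
  unimodular F N -> maxset (independent N) I ->
  exists2 f, f \in coflows N n.+1 & {in I, f =1 g}.
Proof.
move=> [m [phi phiN]] maxI; set q := n.+1.
have [/andP[subI indI] _] := maxsetP maxI.
have /fin_all_exists[C CP] (a : V) : exists C : {set V} * {set V},
    a \in ground N -> a \notin I ->
    [/\ C \in circuits N, a \in supp C & supp C \subset a |: I].
  have [aE|aE] := boolP (a \in ground N); last by exists (set0, set0).
  have [aI|aI] := boolP (a \in I); first by exists (set0, set0).
  by have [C CP] := fundamental_circuit maxI aE aI; exists C.
(* Off the basis, [h a] makes the sum over the fundamental circuit [C a] vanish; the coefficient
   [chi (C a) a] is its own inverse. *)
pose h a : int := if a \in I then (g a : nat)%:Z
  else if a \in ground N then
    - (chi (C a) a * \sum_(b in I) chi (C a) b * (g b : nat)%:Z)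
  else 0.
have fq a : (absz (h a %% q%:Z)%Z < q)%N.
  by rewrite -ltz_nat gez0_abs ?modz_ge0 // ltz_pmod.
pose f : {ffun V -> 'I_q} := [ffun a => Ordinal (fq a)].
have fE a : (f a : nat)%:Z = (h a %% q%:Z)%Z.
  by rewrite ffunE /= gez0_abs // modz_ge0.
have hI a : a \in I -> h a = (g a : nat)%:Z by rewrite /h => ->.
have h0 a : a \notin ground N -> h a = 0.
  by move=> aE; rewrite /h ifN ?ifN //; apply: contra aE; apply/subsetP.
exists f; last first.
  move=> a aI; apply: val_inj; apply/eqP; rewrite -eqz_nat fE hI //.
  by rewrite modz_small // ltz_nat ltn_ord.
rewrite inE; apply/andP; split.
  by apply/forallP=> a; apply/implyP => /h0 ha; rewrite -eqz_nat fE ha mod0z.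
rewrite (@integral_coflow_congr N q _ h) => [|a]; last first.
  by rewrite fE {2}(divz_eq (h a) q%:Z) opprD addrCA addrA addrK rpredN dvdz_mull.
apply/forall_inP=> C0 /(circuit_dependency phiN).
(* A dependency supported on the independent set [I] is zero, which settles the base case;
   fundamental circuits clear the coordinates off [I]. *)
apply: (dependency_dvdz phiN (Q := I)) => {C0} [x xdep xI|x a xdep aI xa].
  rewrite big1 ?dvdz0 // => a _; have [->|xa] := eqVneq (x a) 0; first by rewrite mul0r.
  have [C0 [CN _ sub]] := dependency_circuit phiN xdep xa.
  have /negP[] := forall_inP indI C0 CN; apply/subsetP=> b /sub.
  by apply: contraR => /xI->.
have aE : a \in ground N by apply: contraNT xa => /xdep.1->.
have [CN aC sC] := CP a aE aI; exists (C a); split=> //.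
- have [subC disC _ _] := phiN.1 _ CN.
  rewrite (bigD1 a) //= {1}/h (negPf aI) aE mulrN mulrA chi_sqr // mul1r.
  rewrite [X in - _ + X](bigID (mem I)) /= [X in _ + (_ + X)]big1 => [|b /andP[ba bI]].
    rewrite addr0 [X in - X]big_mkcond [X in _ + X]big_mkcond /= -sumrN -big_split.
    rewrite big1 //= => b _; have [ba|ba] := eqVneq b a; first
      by rewrite ba (negPf aI) oppr0 addr0.
    by case: ifP => bI /=; rewrite ?hI // addNr.
  suff /eqP-> : chi (C a) b == 0 by rewrite mul0r.
  rewrite chi_eq0 //; apply/negP => /(subsetP sC).
  by rewrite !inE (negPf ba) (negPf bI).
- by exists a.
- move=> b /(subsetP sC); rewrite !inE => /orP[/eqP->//|bI].
  by rewrite bI.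
Qed.

(** A value off the basis occurs in its fundamental circuit with coefficient 1 or -1, hence is
    determined modulo q. *)
Lemma coflow_inj N I q (f g : {ffun V -> 'I_q}) :
  unimodular F N -> maxset (independent N) I ->
  f \in coflows N q -> g \in coflows N q -> {in I, f =1 g} -> f = g.
Proof.
move=> [m [phi phiN]] maxI; rewrite !inE.
move=> /andP[/forallP f0 /forall_inP fC] /andP[/forallP g0 /forall_inP gC] fg.
apply/ffunP=> a; have [aI|aI] := boolP (a \in I); first exact: fg.
have [aE|aE] := boolP (a \in ground N); last first.
  apply: val_inj => /=; have := f0 a; have := g0 a.
  by rewrite aE /= => /eqP-> /eqP->.
have [C [CN aC sC]] := fundamental_circuit maxI aE aI.
have [subC disC _ _] := phiN.1 _ CN.
have := rpredB (fC C CN) (gC C CN).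
rewrite -sumrB (bigD1 a) //= big1 => [|b ba].
  rewrite addr0 -mulrBr => /(dvdz_mull (chi C a)).
  rewrite mulrA chi_sqr // mul1r -eqz_mod_dvd.
  rewrite !modz_small ?ltz_nat ?ltn_ord // eqz_nat => /eqP fga.
  exact: val_inj.
have [bI|bI] := boolP (b \in I); first by rewrite fg // subrr.
suff /eqP-> : chi C b == 0 by rewrite !mul0r subrr.
rewrite chi_eq0 //; apply/negP => /(subsetP sC).
by rewrite !inE (negPf ba) (negPf bI).
Qed.

(** Restriction to a deletion, in the encoding by functions vanishing off the ground set. *)
Definition erase n R (f : {ffun V -> 'I_n.+1}) : {ffun V -> 'I_n.+1} :=
  [ffun a => if a \in R then ord0 else f a].

Lemma erase_coflow N n R (f : {ffun V -> 'I_n.+1}) :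
  f \in coflows N n.+1 -> erase R f \in coflows (deletion R N) n.+1.
Proof.
rewrite !inE => /andP[/forallP f0 /forall_inP fC]; apply/andP; split.
  apply/forallP=> a; rewrite inE negb_and negbK ffunE; have := f0 a.
  by case: (a \in R).
apply/forall_inP=> C; rewrite inE => /andP[CN CR]; have := fC C CN.
congr (_ %| _)%Z; apply: eq_bigr => a _; rewrite ffunE; case: ifP => // aR.
have : a \notin supp C by rewrite (disjointFl CR aR).
by rewrite inE negb_or /chi => /andP[/negPf-> /negPf->]; rewrite !mul0r.
Qed.

Lemma independent_deletion N R I :
  independent (deletion R N) I = independent N I && [disjoint I & R].
Proof.
rewrite /independent /= subsetD -!andbA; case: (I \subset ground N) => //=.
rewrite andbC; have [dIR|] := boolP [disjoint I & R]; rewrite ?andbF ?andbT //.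
apply/forall_inP/forall_inP => ind C; last by rewrite inE => /andP[/ind].
move=> CN; apply/negP => sC; apply: (negP (ind C _) sC).
by rewrite inE CN (disjointWl sC dIR).
Qed.

Lemma basis_deletion N R I I0 :
  maxset (independent (deletion R N)) I0 -> independent N I -> I0 \subset I ->
  I :\: R = I0.
Proof.
move=> /maxsetP[]; rewrite independent_deletion => /andP[_ dI0] max0 indI sub.
apply: max0; last by rewrite subsetD sub.
rewrite independent_deletion; apply/andP; split; last first.
  by rewrite disjoint_subset; apply/subsetP=> a; rewrite !inE => /andP[].
move: indI => /andP[subI /forall_inP indI]; apply/andP; split.
  by apply: subset_trans (subsetDl _ _) subI.
apply/forall_inP=> C /indI; apply: contra => /subset_trans; apply; exact: subsetDl.
Qed.

(** A coflow is determined by its values on [I]. Those on [I :\: R = I0] are fixed by [g], and those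
    on [I :&: R] are arbitrary. *)
Lemma card_erase_fiber N n R I I0 (g : {ffun V -> 'I_n.+1}) :
  unimodular F N -> maxset (independent N) I ->
  maxset (independent (deletion R N)) I0 -> I0 \subset I ->
  g \in coflows (deletion R N) n.+1 ->
  #|[set f in coflows N n.+1 | erase R f == g]| = (n.+1 ^ (#|I| - #|I0|))%N.
Proof.
move=> uN maxI max0 sub gN.
have uR := unimodular_deletion R uN.
have indI : independent N I by case/maxsetP: maxI.
have IR : I :\: R = I0 by apply: (basis_deletion max0).
pose A := I :&: R.
have -> : (#|I| - #|I0|)%N = #|A| by rewrite -IR -(cardsID R I) addnK.
pose r (f : {ffun V -> 'I_n.+1}) : {ffun V -> 'I_n.+1} :=
  [ffun a => if a \in A then f a else ord0].
rewrite -[n.+1 in RHS]card_ord -(card_pffun_on (ord0 : 'I_n.+1) (mem A) predT).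
rewrite -(card_in_imset (f := r)) => [|f f']; last first.
  rewrite inE => /andP[fN /eqP fg]; rewrite inE => /andP[f'N /eqP f'g] rff'.
  apply: (coflow_inj uN maxI) => // a aI.
  have [aR|aR] := boolP (a \in R).
    have := congr1 (fun z : {ffun _} => z a) rff'.
    by rewrite !ffunE inE aI aR.
  have := congr1 (fun z : {ffun V -> 'I_n.+1} => z a) f'g.
  by rewrite -fg !ffunE (negPf aR).
apply: eq_card => k; apply/imsetP/pffun_onP => [[f _ ->]|[kA _]].
  split; last by move=> z _.
  by apply/subsetP=> a; rewrite inE ffunE; case: ifP.
have [f fN fE] := coflow_extension
  (fun a => if a \in R then k a else g a) uN maxI.
exists f; last first.
  apply/ffunP=> a; rewrite ffunE; case: ifP => [|aA].
    by rewrite inE => /andP[aI aR]; rewrite fE // aR.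
  apply/eqP; apply: contraFT aA => ka; apply: (subsetP kA).
  by rewrite inE.
rewrite inE fN; apply/eqP; apply: (coflow_inj uR max0) => //.
  exact: erase_coflow.
move=> a; rewrite -IR inE => /andP[aR aI]; rewrite ffunE (negPf aR).
by rewrite fE // (negPf aR).
Qed.

(** The fibre count for deletion of the whole ground set, where the zero function is the only
    coflow. *)
Lemma card_coflows N n I : unimodular F N -> maxset (independent N) I ->
  #|coflows N n.+1| = (n.+1 ^ #|I|)%N.
Proof.
move=> uN maxI; pose g : {ffun V -> 'I_n.+1} := [ffun => ord0].
have gN : g \in coflows (deletion (ground N) N) n.+1.
  rewrite inE; apply/andP; split; first by apply/forallP=> a; rewrite ffunE implybT.
  by apply/forall_inP=> C _; rewrite big1 ?dvdz0 // => a _; rewrite ffunE mulr0.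
have max0 : maxset (independent (deletion (ground N) N)) set0.
  apply/maxsetP; split=> [|I'].
    rewrite independent_deletion -setI_eq0 set0I eqxx andbT.
    have /maxsetP[/andP[_ /forall_inP indI] _] := maxI.
    rewrite /independent sub0set; apply/forall_inP=> C /indI; apply: contra.
    by move/subset_trans; apply; apply: sub0set.
  by rewrite /independent /= setDv subset0 => /andP[/eqP].
have := card_erase_fiber uN maxI max0 (sub0set I) gN.
rewrite cards0 subn0 => <-; apply: eq_card => f; rewrite !inE.
case: (boolP (_ && _)) => //= /andP[/forallP f0 _]; apply/esym/eqP/ffunP => a.
rewrite !ffunE; case: ifP => // aE; apply: val_inj; apply/eqP.
by have := f0 a; rewrite aE.
Qed.

(* All bases have the same size, since each of them gives the same number
   2 ^ #|I| of coflows modulo 2. *)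
Lemma rk_maxset N I : unimodular F N -> maxset (independent N) I -> rk N = #|I|.
Proof.
move=> uN maxI; apply/eqP; rewrite eqn_leq; apply/andP; split; last first.
  have /maxsetP[indI _] := maxI.
  exact: (@leq_bigmax_cond _ (independent N) (fun J : {set V} => #|J|) I indI).
apply/bigmax_leqP => J indJ; have [J' maxJ' sJ] := maxset_exists indJ.
apply: leq_trans (subset_leq_card sJ) _.
have := card_coflows 1 uN maxI; rewrite (card_coflows 1 uN maxJ').
by move/eqP; rewrite eqn_exp2l // => /eqP->.
Qed.

Lemma independent0 N : unimodular F N -> independent N set0.
Proof.
move=> [m [phi [circN _]]]; rewrite /independent sub0set; apply/forall_inP=> C CN.
by have [_ _ _] := circN C CN; rewrite subset0.
Qed.

Lemma card_coflows_deletion N n R (P : pred {ffun V -> 'I_n.+1}) :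
  unimodular F N ->
  (#|[set f in coflows (deletion R N) n.+1 | P f]| *
     n.+1 ^ (rk N - rk (deletion R N)))%N =
  #|[set f in coflows N n.+1 | P (erase R f)]|.
Proof.
move=> uN; have uR := unimodular_deletion R uN.
have [I0 max0 _] := maxset_exists (independent0 uR).
(* A basis of the deletion is independent in [N], so it extends to a basis; the fibre count needs
   this nesting. *)
have [I maxI sub] : {I | maxset (independent N) I & I0 \subset I}.
  apply: maxset_exists; have /maxsetP[+ _] := max0.
  by rewrite independent_deletion => /andP[].
rewrite (rk_maxset uN maxI) (rk_maxset uR max0).
rewrite -[RHS]sum1_card (partition_big (@erase n R)
  (mem [set f in coflows (deletion R N) n.+1 | P f])) /=; last first.
  by move=> f; rewrite inE => /andP[/(erase_coflow R) fN Pf]; rewrite inE fN.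
rewrite -sum_nat_const; apply: eq_bigr => g; rewrite inE => /andP[gN Pg].
rewrite sum1_card -(card_erase_fiber uN maxI max0 sub gN); apply: eq_card => f.
rewrite [LHS]inE [RHS]unfold_in [in RHS]inE -andbA.
by case: (_ =P g) => [->|]; rewrite ?andbF ?Pg ?andbT.
Qed.

End Bases.

(** * Residue maps and reorientations *)

Section ResidueMaps.

Variables (V : finType) (N : signed_system V) (n : nat).

Definition restrict_map (f : {ffun V -> 'I_n.+1}) : residue_map N n.+1 :=
  [ffun x => f (val x)].

Definition extend_map (g : residue_map N n.+1) : {ffun V -> 'I_n.+1} :=
  [ffun a => if insub a is Some x then g x else ord0].

Lemma extend_mapK : cancel extend_map restrict_map.
Proof. by move=> g; apply/ffunP=> x; rewrite !ffunE valK. Qed.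

Lemma restrict_mapK (f : {ffun V -> 'I_n.+1}) :
  (extend_map (restrict_map f) == f) =
  [forall a, (a \notin ground N) ==> (f a == 0 :> nat)].
Proof.
apply/eqP/forallP => [<- a|f0].
  by rewrite ffunE; case: insubP => [x -> //|_]; rewrite eqxx implybT.
apply/ffunP=> a; rewrite ffunE; case: insubP => [x _ xa|aE].
  by rewrite ffunE xa.
by apply: val_inj => /=; have := f0 a; rewrite aE => /eqP->.
Qed.

Lemma sum_restrict (P : pred V) (h : V -> nat) :
  (forall a, a \notin ground N -> P a -> h a = 0%N) ->
  (\sum_(x : {a : V | a \in ground N} | P (val x)) h (val x) = \sum_(a | P a) h a)%N.
Proof.
move=> h0; rewrite -(big_sub_cond (ground N) P h) /= [RHS](bigID (mem (ground N))) /=.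
rewrite [X in _ = (_ + X)%N]big1 ?addn0 => [|a /andP[Pa aE]]; last exact: h0.
by apply: eq_bigl => a; rewrite andbC.
Qed.

Lemma coflow_restrict (f : {ffun V -> 'I_n.+1}) :
  (forall a, a \notin ground N -> f a = 0 :> nat) ->
  coflow (restrict_map f) =
  integral_coflow N n.+1 (fun a => (f a : nat)%:Z).
Proof.
move=> f0; apply: eq_forallb => C; congr (_ ==> _).
have sumE (X : {set V}) :
    (\sum_(x | val x \in X) restrict_map f x = \sum_(a in X) f a)%N.
  rewrite -[RHS](@sum_restrict (mem X) (fun a => f a)) => [|a /f0 //].
  by apply: eq_bigr => x _; rewrite ffunE.
rewrite !sumE -eqz_nat -!modz_nat eqz_mod_dvd; congr (_ %| _)%Z.
have sumZ (X : {set V}) : (\sum_(a in X) f a)%N%:Z = \sum_a (a \in X)%:Z * (f a : nat)%:Z.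
  rewrite -[LHS]natz natr_sum big_mkcond; apply: eq_bigr => a _.
  by case: (a \in X); rewrite ?mul1r ?mul0r ?natz.
by rewrite !sumZ -sumrB; apply: eq_bigr => a _; rewrite /chi mulrBl.
Qed.

(** Moves sums from the type depending on [N] to the common type. The modulus is a successor so that
    [ord0] is available as the value off the ground set. *)
Lemma big_coflow (R : Type) (idx : R) (op : Monoid.com_law idx)
    (P : pred (residue_map N n.+1)) (G : residue_map N n.+1 -> R) :
  \big[op/idx]_(g | coflow g && P g) G g =
  \big[op/idx]_(f in coflows N n.+1 | P (restrict_map f)) G (restrict_map f).
Proof.
rewrite (reindex_onto restrict_map extend_map) => [|g _]; last exact: extend_mapK.
apply: eq_bigl => f; rewrite restrict_mapK inE andbC andbA.
congr (_ && _); case: (boolP [forall a, _]) => //= /forallP f0.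
apply: coflow_restrict => a aE; apply/eqP.
by have := f0 a; rewrite aE.
Qed.

Hypothesis qodd : odd n.+1.

Lemma residue_sign_gt k :
  (0 < k <= n.+1./2)%N = (residue_sign n.+1 k == Some true).
Proof.
rewrite /residue_sign; case: (k =P 0) => [->//|k0].
by rewrite lt0n; have -> : (k != 0) by apply/eqP; case: (k <= _)%N.
Qed.

Lemma residue_sign_lt k : (k < n.+1)%N ->
  (0 < (n.+1 - k) %% n.+1 <= n.+1./2)%N = (residue_sign n.+1 k == Some false).
Proof.
move=> kq; rewrite /residue_sign; case: (k =P 0) => [->|k0].
  by rewrite subn0 modnn.
have := odd_double_half n.+1; rewrite qodd => hq.
rewrite modn_small; last by lia.
have -> : (0 < n.+1 - k <= n.+1./2)%N = ~~ (k <= n.+1./2)%N by lia.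
by case: (k <= _)%N.
Qed.

Lemma card_gt_part (f : {ffun V -> 'I_n.+1}) : f \in coflows N n.+1 ->
  #|gt_part (restrict_map f)| = #|[set a | pattern f a == Some true]|.
Proof.
rewrite inE => /andP[/forallP f0 _].
rewrite -sum1_card -sum1dep_card /gt_part.
rewrite -[RHS](@sum_restrict (fun a => pattern f a == Some true) (fun=> 1%N)).
  by apply: eq_bigl => x; rewrite !inE !ffunE residue_sign_gt.
by move=> a aE; rewrite ffunE; have := f0 a; rewrite aE => /eqP->.
Qed.

Lemma card_lt_part (f : {ffun V -> 'I_n.+1}) : f \in coflows N n.+1 ->
  #|lt_part (restrict_map f)| = #|[set a | pattern f a == Some false]|.
Proof.
rewrite inE => /andP[/forallP f0 _].
rewrite -sum1_card -sum1dep_card /lt_part.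
rewrite -[RHS](@sum_restrict (fun a => pattern f a == Some false) (fun=> 1%N)).
  by apply: eq_bigl => x; rewrite !inE !ffunE residue_sign_lt ?ltn_ord.
by move=> a aE; rewrite ffunE; have := f0 a; rewrite aE => /eqP->.
Qed.

End ResidueMaps.

(** * Counting coflows under constraints on their signs *)

Section PatternCounts.

Variable V : finType.
Implicit Types (N : signed_system V) (D : V -> option bool -> bool).

(** [D a] is the set of signs allowed at [a]. Reorientation, deletion and contraction then change
    only [D], apart from a power of q for deletion. *)
Definition pattern_count N D (q : nat) : nat :=
  #|[set f in coflows N q | [forall a in ground N, D a (pattern f a)]]|.

Definition flip n (T : {set V}) (f : {ffun V -> 'I_n.+1}) : {ffun V -> 'I_n.+1} :=
  [ffun a => if a \in T then inord ((n.+1 - f a) %% n.+1)%N else f a].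

Lemma flipE n T (f : {ffun V -> 'I_n.+1}) a :
  flip T f a = (if a \in T then (n.+1 - f a) %% n.+1 else f a)%N :> nat.
Proof. by rewrite ffunE; case: ifP => // _; rewrite inordK // ltn_pmod. Qed.

Lemma flipK n T : involutive (@flip n T).
Proof.
move=> f; apply/ffunP=> a; apply: val_inj; rewrite /= flipE flipE; case: (a \in T) => //.
have fq := ltn_ord (f a); have [->|f0] := posnP (f a); first by rewrite !(subn0, modnn).
rewrite [X in (_ - X)%N]modn_small; last by lia.
by rewrite subKn ?modn_small // ltnW.
Qed.

Lemma pattern_flip n T (f : {ffun V -> 'I_n.+1}) a : odd n.+1 ->
  pattern (flip T f) a =
  if a \in T then omap negb (pattern f a) else pattern f a.
Proof.
move=> qodd; rewrite [LHS]ffunE flipE [pattern f a]ffunE; case: (a \in T) => //.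
have fq := ltn_ord (f a).
have [->|f0] := posnP (f a); first by rewrite subn0 modnn.
have := odd_double_half n.+1; rewrite qodd => hq.
rewrite modn_small; last by lia.
rewrite /residue_sign !ifF /=; [congr Some; lia|lia|lia].
Qed.

(** Negating a value on [T] has the same effect on circuit sums as negating the circuit's sign
    there. *)
Lemma flip_coflow N n T (f : {ffun V -> 'I_n.+1}) :
  (flip T f \in coflows N n.+1) = (f \in coflows (reorientation T N) n.+1).
Proof.
rewrite !inE; congr (_ && _).
  apply: eq_forallb => a; congr (_ ==> _); rewrite flipE; case: ifP => // _.
  have [->|f0] := posnP (f a); first by rewrite subn0 modnn.
  by rewrite modn_small; have := ltn_ord (f a); lia.
have chiT C a : chi (reorient_signed T C) a = if a \in T then - chi C a else chi C a.
  rewrite /chi !inE; case: (a \in T); rewrite ?andbT ?andbF ?orbF //=.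
  by rewrite opprB.
have dvdT C : (n.+1%:Z %| \sum_a chi C a * (flip T f a : nat)%:Z)%Z =
    (n.+1%:Z %| \sum_a chi (reorient_signed T C) a * (f a : nat)%:Z)%Z.
  rewrite (dvdz_sum_congr _ (g := fun a => (if a \in T then - 1 else 1) * (f a : nat)%:Z)).
    congr (_ %| _)%Z; apply: eq_bigr => a _; rewrite chiT.
    by case: ifP => _; rewrite ?mulN1r ?mul1r ?mulrN ?mulNr.
  move=> a; rewrite flipE; case: ifP => _; last by rewrite mul1r subrr dvdz0.
  have fq := ltnW (ltn_ord (f a)).
  have -> : (((n.+1 - f a) %% n.+1)%N%:Z - -1 * (f a : nat)%:Z) =
      ((n.+1 - f a) %% n.+1)%N%:Z - (n.+1 - f a)%N%:Z + n.+1%:Z.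
    by rewrite -subzn //; ring.
  by rewrite rpredD ?dvdzz ?dvdz_modn_sub.
apply/forall_inP/forall_inP => [cof C /imsetP[D DN ->]|cof C CN].
  by rewrite -dvdT cof.
by rewrite dvdT cof // imset_f.
Qed.

Lemma pattern_count_reorientation N D T n : odd n.+1 ->
  pattern_count (reorientation T N) D n.+1 =
  pattern_count N (fun a s => D a (if a \in T then omap negb s else s)) n.+1.
Proof.
move=> qodd; rewrite /pattern_count -(card_imset _ (inv_inj (@flipK n T))).
apply: eq_card => f; rewrite (can_imset_pre _ (@flipK n T)) inE [LHS]inE [RHS]inE.
rewrite -flip_coflow flipK; congr (_ && _); apply: eq_forallb => a.
by rewrite pattern_flip.
Qed.

Lemma strict_count N n : odd n.+1 ->
  #|[set f : residue_map N n.+1 | coflow f & [forall a, (0 < f a <= n.+1./2)%N]]| =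
  pattern_count N (fun _ s => s == Some true) n.+1.
Proof.
move=> qodd; rewrite -sum1_card; under eq_bigl do rewrite inE.
rewrite big_coflow sum1dep_card; apply: eq_card => f; rewrite [LHS]inE [RHS]inE.
congr (_ && _); apply/forallP/forall_inP => [fE a aE|fE x].
  by have := fE (exist _ a aE); rewrite !ffunE residue_sign_gt.
by rewrite ffunE residue_sign_gt; have := fE _ (valP x); rewrite ffunE.
Qed.

Lemma weak_count N n : odd n.+1 ->
  #|[set f : residue_map N n.+1 | coflow f & [forall a, (f a <= n.+1./2)%N]]| =
  pattern_count N (fun _ s => s != Some false) n.+1.
Proof.
move=> qodd; have leE k : (k <= n.+1./2)%N = (residue_sign n.+1 k != Some false).
  by rewrite /residue_sign; case: (k =P 0) => [->//|_]; case: (k <= _)%N.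
rewrite -sum1_card; under eq_bigl do rewrite inE.
rewrite big_coflow sum1dep_card; apply: eq_card => f; rewrite [LHS]inE [RHS]inE.
congr (_ && _); apply/forallP/forall_inP => [fE a aE|fE x].
  by have := fE (exist _ a aE); rewrite !ffunE leE.
by rewrite ffunE leE; have := fE _ (valP x); rewrite ffunE.
Qed.

End PatternCounts.

(** * The polynomials *)

Section Specifications.

Variables (F : realFieldType) (K : fieldType) (V : finType).
Hypothesis hK : [pchar K] =i pred0.
Implicit Types (N : signed_system V) (D : V -> option bool -> bool).

Definition pattern_on N (sigma : {ffun V -> option bool}) : bool :=
  [forall a, (a \notin ground N) ==> (sigma a == None)].

Lemma pattern_coflow N q (f : {ffun V -> 'I_q}) :
  f \in coflows N q -> pattern_on N (pattern f).
Proof.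
rewrite inE => /andP[/forallP f0 _]; apply/forallP => a; apply/implyP => aE.
by have := f0 a; rewrite aE ffunE => /eqP->.
Qed.

Lemma sum_by_pattern N q (G : {ffun V -> option bool} -> K) :
  \sum_(f in coflows N q) G (pattern f) =
  \sum_(sigma | pattern_on N sigma)
     #|[set f in coflows N q | pattern f == sigma]|%:R * G sigma.
Proof.
rewrite (partition_big (@pattern V q) (pattern_on N)) /=; last exact: pattern_coflow.
apply: eq_bigr => sigma _; rewrite -sum1_card natr_sum mulr_suml.
under [RHS]eq_bigl do rewrite inE.
by apply: eq_bigr => f /andP[_ /eqP->]; rewrite mul1r.
Qed.

Lemma pattern_countE N D q :
  (pattern_count N D q)%:R = \sum_(f in coflows N q)
     \prod_(a in ground N) (D a (pattern f a))%:R :> K.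
Proof.
rewrite /pattern_count -sum1_card natr_sum; under eq_bigl do rewrite inE.
rewrite big_mkcondr /=; apply: eq_bigr => f _; case: ifP => [/forall_inP Df|].
  by rewrite big1 // => a /Df->.
by move=> /negbT /forall_inPn[a aE /negPf nD]; rewrite (bigD1 a) //= nD mul0r.
Qed.

Lemma pattern_count_parity_poly N D : unimodular F N ->
  parity_poly true (fun q => (pattern_count N D q)%:R : K).
Proof.
move=> uN; pose G (sigma : {ffun V -> option bool}) : K :=
  \prod_(a in ground N) (D a (sigma a))%:R.
apply: (parity_poly_ext (f := fun q => \sum_(sigma | pattern_on N sigma)
   #|[set f in coflows N q | pattern f == sigma]|%:R * G sigma)) => [q _|].
  by rewrite pattern_countE -(sum_by_pattern N q G).
apply: parity_poly_sum => sigma /forallP sE.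
apply: parity_polyM; last exact: parity_poly_cst.
apply: (card_pattern_parity_poly hK uN) => a aE; apply/eqP.
by have := sE a; rewrite aE.
Qed.

Lemma eq_pattern_count N D D' q : (forall a s, D a s = D' a s) ->
  pattern_count N D q = pattern_count N D' q.
Proof.
move=> DD'; apply: eq_card => f; rewrite [LHS]inE [RHS]inE.
by congr (_ && _); apply: eq_forallb => a; rewrite DD'.
Qed.

(** Deleting [R] lifts all constraints there, and the power of q is the size of the fibres of
    [erase]. *)
Lemma pattern_count_deletion N D (R : {set V}) n : unimodular F N ->
  (n.+1 ^ (rk N - rk (deletion R N)) * pattern_count (deletion R N) D n.+1)%N =
  pattern_count N (fun a s => (a \in R) || D a s) n.+1.
Proof.
move=> uN; rewrite mulnC (@card_coflows_deletion F V N n R (fun f =>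
  [forall a in ground (deletion R N), D a (pattern f a)]) uN).
apply: eq_card => f; rewrite [LHS]inE [RHS]inE; congr (_ && _).
apply: eq_forallb => a; rewrite inE !ffunE.
by case: (a \in R); rewrite ?implybT.
Qed.

Lemma pattern_count_contraction N D (R : {set V}) n : unimodular F N ->
  R \subset ground N ->
  pattern_count (contraction R N) D n.+1 =
  pattern_count N (fun a s => if a \in R then s == None else D a s) n.+1.
Proof.
move=> [m [phi phiN]] RE; apply: eq_card => f; rewrite [LHS]inE [RHS]inE.
have sign0 a : (pattern f a == None) = (f a == 0 :> nat).
  by rewrite ffunE /residue_sign; case: (f a == 0 :> nat).
apply/andP/andP => -[].
  rewrite !inE => /andP[/forallP f0 fC] /forall_inP Df.
  have fR : {in R, forall a, f a = 0 :> nat}.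
    by move=> a aR; apply/eqP; have := f0 a; rewrite !inE aR.
  rewrite -(contraction_coflow phiN (R := R)) => [|a /fR->//].
  split; last first.
    apply/forall_inP=> a aE; case: ifP => aR; first by rewrite sign0 fR.
    by apply: Df; rewrite inE aR.
  rewrite fC andbT; apply/forallP=> a; apply/implyP => aE.
  by have := f0 a; rewrite inE negb_and aE orbT.
rewrite !inE => /andP[/forallP f0 fC] /forall_inP Df.
have fR : {in R, forall a, f a = 0 :> nat}.
  move=> a aR; apply/eqP; rewrite -sign0.
  by have := Df a (subsetP RE a aR); rewrite aR.
rewrite (contraction_coflow phiN (R := R)) => [|a /fR->//].
split; last first.
  by apply/forall_inP=> a; rewrite inE => /andP[aR aE]; have := Df a aE; rewrite (negPf aR).
rewrite fC andbT; apply/forallP=> a; rewrite inE negb_and negbK.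
by case: (boolP (a \in R)) => [/fR->//|_]; apply: f0.
Qed.

Lemma A_polynomialP N : unimodular F N ->
  is_A_polynomial N (A_polynomial K N).
Proof.
move=> uN; apply: epsilon_spec.
have /fin_all_exists[P PE] (sigma : {ffun V -> option bool}) :
    exists P : {poly K}, pattern_on N sigma -> forall q, odd q ->
      #|[set f in coflows N q | pattern f == sigma]|%:R = P.[q%:R].
  have [/forallP sE|] := boolP (pattern_on N sigma); last by exists 0.
  have [|P PE] := card_pattern_parity_poly (sigma := sigma) hK uN.
    by move=> a aE; apply/eqP; have := sE a; rewrite aE.
  by exists P => _ q qodd; rewrite PE //; case: q qodd.
pose X (i : nat) : {mpoly K[3]} := 'X_(inord i).
(* The univariate polynomial of each pattern is placed in the first variable and multiplied by the
   monomial in y and z that the pattern contributes. *)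
exists (\sum_(sigma | pattern_on N sigma)
  (\sum_(i < size (P sigma)) (P sigma)`_i *: X 0%N ^+ i) *
  (X 1%N ^+ #|[set a | sigma a == Some true]| * X 2%N ^+ #|[set a | sigma a == Some false]|)).
case=> // n qodd y z; pose q := n.+1.
have XE i (w : 'I_3 -> K) : (X i).@[w] = w (inord i) by rewrite mevalXU.
have tE : (tnth [tuple q%:R; y; z] (inord 0) = q%:R)
    * (tnth [tuple q%:R; y; z] (inord 1) = y)
    * (tnth [tuple q%:R; y; z] (inord 2) = z).
  by rewrite !(tnth_nth 0) /= !inordK.
rewrite [RHS](eq_bigl (fun f => coflow f && xpredT f)) => [|f]; last first.
  by rewrite andbT.
rewrite (@big_coflow V N n _ _ _ xpredT) /=.
pose G (sigma : {ffun V -> option bool}) :=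
  y ^+ #|[set a | sigma a == Some true]| * z ^+ #|[set a | sigma a == Some false]|.
under [RHS]eq_bigl do rewrite andbT.
rewrite [RHS](eq_bigr (fun f => G (pattern f))) => [|f fN]; last first.
  by rewrite card_gt_part // card_lt_part.
rewrite sum_by_pattern rmorph_sum; apply: eq_bigr => sigma sE /=.
rewrite !rmorphM !rmorphXn /= !XE !tE PE // horner_coef rmorph_sum.
by congr (_ * _); apply: eq_bigr => i _; rewrite /= mevalZ rmorphXn /= XE tE.
Qed.

(** Isolates what the existence of characteristic polynomials requires; for contractions it is
    inherited from [N]. *)
Definition pattern_polynomial N : Prop :=
  forall D, parity_poly true (fun q => (pattern_count N D q)%:R : K).

Lemma strict_char_polynomialE N T n : pattern_polynomial N -> odd n.+1 ->
  (strict_char_polynomial K (reorientation T N)).[n.+1%:R] =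
  (pattern_count N (fun a s => s == Some (a \notin T)) n.+1)%:R.
Proof.
move=> pN nodd.
have cntE k : odd k.+1 ->
    #|[set f : residue_map (reorientation T N) k.+1 |
        coflow f & [forall a, (0 < f a <= k.+1./2)%N]]| =
    pattern_count N (fun a s => s == Some (a \notin T)) k.+1.
  move=> kodd; rewrite strict_count // pattern_count_reorientation //.
  by apply: eq_pattern_count => a [[]|]; case: (a \in T).
have : is_strict_char_polynomial (reorientation T N)
    (strict_char_polynomial K (reorientation T N)).
  apply: epsilon_spec; have [P PE] := pN (fun a s => s == Some (a \notin T)).
  by exists P => -[//|k] kodd; rewrite cntE // PE.
by move=> ->; rewrite ?cntE.
Qed.

Lemma weak_char_polynomialE N T n : pattern_polynomial N -> odd n.+1 ->
  (weak_char_polynomial K (reorientation T N)).[n.+1%:R] =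
  (pattern_count N (fun a s => s != Some (a \in T)) n.+1)%:R.
Proof.
move=> pN nodd.
have cntE k : odd k.+1 ->
    #|[set f : residue_map (reorientation T N) k.+1 |
        coflow f & [forall a, (f a <= k.+1./2)%N]]| =
    pattern_count N (fun a s => s != Some (a \in T)) k.+1.
  move=> kodd; rewrite weak_count // pattern_count_reorientation //.
  by apply: eq_pattern_count => a [[]|]; case: (a \in T).
have : is_weak_char_polynomial (reorientation T N)
    (weak_char_polynomial K (reorientation T N)).
  apply: epsilon_spec; have [P PE] := pN (fun a s => s != Some (a \in T)).
  by exists P => -[//|k] kodd; rewrite cntE // PE.
by move=> ->; rewrite ?cntE.
Qed.

Lemma pattern_polynomial_deletion N R :
  unimodular F N -> pattern_polynomial (deletion R N).
Proof. by move=> uN D; apply/pattern_count_parity_poly/unimodular_deletion. Qed.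

Lemma pattern_polynomial_contraction N (R : {set V}) : R \subset ground N ->
  unimodular F N -> pattern_polynomial (contraction R N).
Proof.
move=> RE uN D; apply: parity_poly_ext (pattern_count_parity_poly
  (fun a s => if a \in R then s == None else D a s) uN).
by case=> // n _; rewrite (pattern_count_contraction _ _ uN).
Qed.

End Specifications.

(** * Sums over ordered partitions *)

Section PartitionSums.

Variables (K : fieldType) (V : finType).
Implicit Types (E R S T : {set V}).

Lemma ordered_partition3_sub E R S T :
  ordered_partition3 E R S T ->
  [/\ R \subset E, S \subset E & T \subset E].
Proof.
case/and4P => _ _ _ /eqP<-; split; apply/subsetP=> a; rewrite !inE => ->;
  by rewrite ?orbT.
Qed.

Lemma ordered_partition3_prod E R S T (g : V -> K) :
  ordered_partition3 E R S T ->
  \prod_(a in E) g a =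
  (\prod_(a in R) g a) * (\prod_(a in S) g a) * (\prod_(a in T) g a).
Proof.
case/and4P => dRS dRT dST /eqP<-; rewrite [LHS]big_mkcond.
rewrite [X in X * _ * _]big_mkcond [X in _ * X * _]big_mkcond [X in _ * X]big_mkcond.
rewrite -!big_split /=.
apply: eq_bigr => a _; rewrite !inE.
have [aR|_] := boolP (a \in R).
  by rewrite (disjointFr dRS aR) (disjointFr dRT aR) !mulr1.
have [aS|_] := boolP (a \in S); last by rewrite !mul1r.
by rewrite (disjointFr dST aS) mul1r mulr1.
Qed.

(** Expanding the product selects one of three summands for each element of [E], and such a
    selection is an ordered partition. *)
Lemma sum_ordered_partition3 E (u v w : V -> K) :
  \sum_R \sum_S \sum_(T | ordered_partition3 E R S T)
    (\prod_(a in R) u a) * (\prod_(a in S) v a) * (\prod_(a in T) w a) =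
  \prod_(a in E) (u a + v a + w a).
Proof.
pose g a (s : option bool) :=
  if s is Some b then if b then v a else w a else u a.
transitivity (\prod_(a in E) \sum_(s : option bool) g a s); last first.
  apply: eq_bigr => a _; rewrite (bigD1 None) //= (bigD1 (Some true)) //=.
  rewrite (bigD1 (Some false)) //= big1 ?addr0 ?addrA //.
  by case=> [[]|].
rewrite (big_distr_big None) pair_big /= pair_big_dep /=.
(* Off [E] the selections also have value [None], so the first component must be cut down to [E]. *)
pose h (f : {ffun V -> option bool}) : ({set V} * {set V}) * {set V} :=
  ([set a in E | f a == None], [set a | f a == Some true], [set a | f a == Some false]).
pose h' (p : ({set V} * {set V}) * {set V}) : {ffun V -> option bool} :=
  [ffun a => if a \in p.1.2 then Some true else if a \in p.2 then Some false else None].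
rewrite (reindex_onto h h') /=.
  have h'K f : h' (h f) = f.
    by apply/ffunP=> a; rewrite ffunE !inE; case: (f a) => [[]|].
  have hP f : ordered_partition3 E (h f).1.1 (h f).1.2 (h f).2 =
      (f \in pffun_on None (mem E) predT).
    apply/idP/pffun_onP => [/ordered_partition3_sub[_ /subsetP SE /subsetP TE]|[fE _]].
      split=> //; apply/subsetP=> a; rewrite inE.
      case fa: (f a) => [[]|] // _; first by apply: SE; rewrite inE fa.
      by apply: TE; rewrite inE fa.
    have fN a : a \in E = false -> f a = None.
      move=> aE; apply/eqP; apply: contraFT aE => fa.
      by apply: (subsetP fE); rewrite inE.
    apply/and4P; split; try (rewrite disjoint_subset; apply/subsetP=> a;
      rewrite !inE /=; by case: (f a) => [[]|]; rewrite ?andbF).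
    apply/eqP/setP=> a; rewrite !inE; case: (boolP (a \in E)) => aE /=.
      by case: (f a) => [[]|].
    by rewrite fN //; apply: negbTE.
  apply: eq_big => [f|f /andP[part _]]; first by rewrite h'K eqxx andbT hP.
  rewrite (ordered_partition3_prod _ part); congr (_ * _ * _);
    apply: eq_bigr => a; rewrite inE.
  - by case/andP => _ /eqP->.
  - by move/eqP->.
  - by move/eqP->.
move=> [[R S] T] /= part; have [RE SE TE] := ordered_partition3_sub part.
case/and4P: part => dRS dRT dST /eqP EE.
congr (_, _, _); apply/setP=> a; rewrite !inE ffunE /=.
- rewrite -EE !inE; have [aR|aR] := boolP (a \in R).
    by rewrite (disjointFr dRS aR) (disjointFr dRT aR).
  by case: (a \in S) => //; case: (a \in T).
- by case: ifP => // _; case: ifP.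
- case: ifP => [aS|_]; last by case: ifP.
  by rewrite (disjointFr dST aS).
Qed.

End PartitionSums.

(** * Polynomial identities from values at odd integers *)

Section PolynomialFunctions.

Variable K : fieldType.
Hypothesis hK : [pchar K] =i pred0.

Definition polynomial_function (f : K -> K) : Prop :=
  exists P : {poly K}, forall q, f q = P.[q].

Lemma polynomial_function_cst c : polynomial_function (fun=> c).
Proof. by exists c%:P => q; rewrite hornerC. Qed.

Lemma polynomial_functionM f g :
  polynomial_function f -> polynomial_function g ->
  polynomial_function (fun q => f q * g q).
Proof. by move=> [P fP] [Q gQ]; exists (P * Q) => q; rewrite hornerM fP gQ. Qed.

Lemma polynomial_functionX f k :
  polynomial_function f -> polynomial_function (fun q => f q ^+ k).
Proof. by move=> [P fP]; exists (P ^+ k) => q; rewrite horner_exp fP. Qed.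

Lemma polynomial_function_sum (I : Type) (r : seq I) (B : pred I) (f : I -> K -> K) :
  (forall i, polynomial_function (f i)) ->
  polynomial_function (fun q => \sum_(i <- r | B i) f i q).
Proof.
move=> fP; elim: r => [|i r [P IHr]].
  by exists 0 => q; rewrite big_nil horner0.
have [Q fQ] := fP i; exists (if B i then Q + P else P) => q.
by rewrite big_cons; case: ifP => _; rewrite ?hornerD -?fQ IHr.
Qed.

Lemma polynomial_function_meval (A : {mpoly K[3]}) y z :
  polynomial_function (fun q => A.@[tnth [tuple q; y; z]]).
Proof.
pose t (i : 'I_3) : {poly K} := tnth [tuple 'X; y%:P; z%:P] i.
exists (\sum_(m <- msupp A) A@_m *: \prod_i t i ^+ m i) => q.
rewrite mevalE horner_sum; apply: eq_bigr => m _.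
rewrite hornerZ horner_prod; congr (_ * _); apply: eq_bigr => i _.
rewrite horner_exp; congr (_ ^+ _); rewrite /t !(tnth_nth 0) /=.
by case: i => [[|[|[|//]]] ?]; rewrite /= ?hornerX ?hornerC.
Qed.

(** In characteristic 0 the odd integers are pairwise distinct, so the difference polynomial has
    more roots than its degree allows. *)
Lemma polynomial_function_odd_eq f g :
  polynomial_function f -> polynomial_function g ->
  (forall n, odd n.+1 -> f n.+1%:R = g n.+1%:R) -> f =1 g.
Proof.
move=> [P fP] [Q gQ] fg q; rewrite fP gQ; congr _.[_]; apply/eqP.
rewrite -subr_eq0; apply/eqP.
pose rs : seq K := [seq (k.*2.+1)%:R | k <- iota 0 (size (P - Q))].
apply: (@roots_geq_poly_eq0 _ _ rs); last by rewrite size_map size_iota.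
  apply/allP=> _ /mapP[k _ ->]; rewrite /root hornerD hornerN -fP -gQ fg ?subrr //.
  by rewrite /= odd_double.
rewrite map_inj_uniq ?iota_uniq // => k l /eqP.
wlog kl : k l / (k <= l)%N => [W|].
  by case: (leqP k l) => [/W//|/ltnW/W {}W]; rewrite eq_sym => /W->.
rewrite eq_sym -subr_eq0 -natrB ?ltnS ?leq_double // ((pcharf0P K).1 hK) subSS -doubleB.
by rewrite double_eq0 subn_eq0 => lk; apply/eqP; rewrite eqn_leq kl.
Qed.

End PolynomialFunctions.

(** Common form of the four identities: [bR], [bS] and [bT] are the signs allowed on [R], [S] and
    [T]. Since zero values contribute 1 to the A-polynomial, the weights are normalised by
    [weight None]. *)
Lemma partition_identity (F : realFieldType) (K : fieldType) (V : finType)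
    (N : signed_system V) (bR bS bT : pred (option bool))
    (cp : {set V} -> {set V} -> {poly K}) (e : {set V} -> nat) (q y z : K) :
  [pchar K] =i pred0 -> unimodular F N ->
  (forall R S T n, ordered_partition3 (ground N) R S T -> odd n.+1 ->
     n.+1%:R ^+ e R * (cp R T).[n.+1%:R] =
     (pattern_count N (fun a s => if a \in R then bR s
                                  else if a \in T then bT s else bS s) n.+1)%:R) ->
  let weight s := (bR s)%:R + y * (bS s)%:R + z * (bT s)%:R in
  weight None != 0 ->
  \sum_(R : {set V}) \sum_(S : {set V})
    \sum_(T : {set V} | ordered_partition3 (ground N) R S T)
      y ^+ #|S| * z ^+ #|T| * q ^+ e R * (cp R T).[q] =
  weight None ^+ #|ground N| *
    (A_polynomial K N).@[tnth [tuple q; weight (Some true) / weight None;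
                                        weight (Some false) / weight None]].
Proof.
move=> hK uN cpE weight w0.
pose lhs x := \sum_(R : {set V}) \sum_(S : {set V})
    \sum_(T : {set V} | ordered_partition3 (ground N) R S T)
      y ^+ #|S| * z ^+ #|T| * x ^+ e R * (cp R T).[x].
pose rhs x := weight None ^+ #|ground N| *
    (A_polynomial K N).@[tnth [tuple x; weight (Some true) / weight None;
                                        weight (Some false) / weight None]].
rewrite -/(lhs q) -/(rhs q).
(* For fixed y and z both sides are polynomial in q, so it suffices to compare them at odd integers,
   where they count. *)
apply: (polynomial_function_odd_eq hK) q => [||n nodd].
- apply: polynomial_function_sum => R; apply: polynomial_function_sum => S.
  apply: polynomial_function_sum => T.
  apply: polynomial_functionM; last by exists (cp R T).
  apply: polynomial_functionM; first exact: polynomial_function_cst.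
  by apply: polynomial_functionX; exists 'X => x; rewrite hornerX.
- apply: polynomial_functionM; first exact: polynomial_function_cst.
  exact: polynomial_function_meval.
rewrite /rhs (A_polynomialP hK uN nodd).
rewrite [X in _ * X](eq_bigl (fun f => coflow f && xpredT f)) => [|f]; last first.
  by rewrite andbT.
rewrite (@big_coflow V N n _ _ _ xpredT) /= mulr_sumr.
transitivity (\sum_(f in coflows N n.+1) \prod_(a in ground N) weight (pattern f a)).
  rewrite /lhs.
  pose u (f : {ffun V -> 'I_n.+1}) a : K := (bR (pattern f a))%:R.
  pose v (f : {ffun V -> 'I_n.+1}) a : K := y * (bS (pattern f a))%:R.
  pose w (f : {ffun V -> 'I_n.+1}) a : K := z * (bT (pattern f a))%:R.
  under [RHS]eq_bigr => f _ do
    rewrite -(sum_ordered_partition3 (ground N) (u f) (v f) (w f)).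
  rewrite [RHS]exchange_big /=; apply: eq_bigr => R _.
  rewrite [RHS]exchange_big /=; apply: eq_bigr => S _.
  rewrite [RHS]exchange_big /=; apply: eq_bigr => T part.
  rewrite -mulrA (cpE _ _ _ _ part) // pattern_countE mulr_sumr; apply: eq_bigr => f _.
  rewrite (ordered_partition3_prod _ part).
  case/and4P: part => dRS dRT dST _.
  rewrite (eq_bigr (u f)) => [|a ->//].
  rewrite [X in _ * (_ * X * _)](eq_bigr (fun a => (bS (pattern f a))%:R))
    => [|a aS]; last first.
    by rewrite (disjointFl dRS aS) (disjointFr dST aS).
  rewrite [X in _ * (_ * _ * X)](eq_bigr (fun a => (bT (pattern f a))%:R))
    => [|a aT]; last first.
    by rewrite (disjointFl dRT aT) aT.
  rewrite /v /w !big_split /= !prodr_const; ring.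
apply: eq_big => [f|f fN]; first by rewrite andbT.
rewrite card_gt_part // card_lt_part //.
have fE a : a \notin ground N -> pattern f a = None.
  by have /forallP/(_ a) := pattern_coflow fN => /implyP h /h /eqP.
have splitE (G : V -> K) : \prod_(a in ground N) G a =
    \prod_(a in ground N | pattern f a == None) G a *
    \prod_(a | pattern f a == Some true) G a *
    \prod_(a | pattern f a == Some false) G a.
  rewrite [LHS]big_mkcond.
  rewrite [X in X * _ * _]big_mkcond [X in _ * X * _]big_mkcond [X in _ * X]big_mkcond.
  rewrite -!big_split; apply: eq_bigr => a _ /=.
  have := fE a; case: (pattern f a) => [[]|]; case: (a \in ground N) => //= h;
    by rewrite ?mulr1 ?mul1r //; have := h isT.
(* [W None] is 1, so only the nonzero values of [f] remain in the product. *)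
pose W (s : option bool) := weight s / weight None.
transitivity (\prod_(a in ground N) (weight None * W (pattern f a))).
  by apply: eq_bigr => a _; rewrite /W mulrC divfK.
rewrite big_split /= prodr_const; congr (_ * _); rewrite splitE.
rewrite big1 => [|a /andP[_ /eqP->]]; last by rewrite /W divff.
rewrite mul1r -!prodr_const; congr (_ * _);
  by under [RHS]eq_bigl do rewrite inE; apply: eq_bigr => a /eqP->.
Qed.

Theorem theorem5p3 (RR : realType) (V : finType) (N : signed_system V)
    (hN : regular RR N) (K : fieldType) (hK : [pchar K] =i pred0) :
  (forall q y z : K,
    \sum_(R : {set V}) \sum_(S : {set V})
      \sum_(T : {set V} | ordered_partition3 (ground N) R S T)
        y ^+ #|S| * z ^+ #|T| * q ^+ (rk N - rk (deletion R N))%N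
          * (strict_char_polynomial K (reorientation T (deletion R N))).[q]
    = (A_polynomial K N).@[tnth [tuple q; 1 + y; 1 + z]])
  /\
  (forall q y z : K, 1 + y + z != 0 ->
    \sum_(R : {set V}) \sum_(S : {set V})
      \sum_(T : {set V} | ordered_partition3 (ground N) R S T)
        y ^+ #|S| * z ^+ #|T| * q ^+ (rk N - rk (deletion R N))%N
          * (weak_char_polynomial K (reorientation T (deletion R N))).[q]
    = (1 + y + z) ^+ #|ground N|
        * (A_polynomial K N).@[tnth [tuple q; (1 + y) / (1 + y + z);
                                              (1 + z) / (1 + y + z)]])
  /\
  (forall q y z : K,
    \sum_(R : {set V}) \sum_(S : {set V})
      \sum_(T : {set V} | ordered_partition3 (ground N) R S T)
        y ^+ #|S| * z ^+ #|T|
          * (strict_char_polynomial K (reorientation T (contraction R N))).[q]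
    = (A_polynomial K N).@[tnth [tuple q; y; z]])
  /\
  (forall q y z : K, 1 + y + z != 0 ->
    \sum_(R : {set V}) \sum_(S : {set V})
      \sum_(T : {set V} | ordered_partition3 (ground N) R S T)
        y ^+ #|S| * z ^+ #|T|
          * (weak_char_polynomial K (reorientation T (contraction R N))).[q]
    = (1 + y + z) ^+ #|ground N|
        * (A_polynomial K N).@[tnth [tuple q; y / (1 + y + z);
                                              z / (1 + y + z)]]).
Proof.
have uN := regular_unimodular hN.
have part_sub := @ordered_partition3_sub V (ground N).
split; [|split; [|split]] => q y z.
(* Signs are unconstrained on [R], positive on [S], negative on [T]: the weights of zero, positive
   and negative are 1, [1 + y] and [1 + z]. *)
- rewrite (partition_identity (bR := predT) (bS := pred1 (Some true))
    (bT := pred1 (Some false)) (e := fun R => (rk N - rk (deletion R N))%N)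
    (cp := fun R T => strict_char_polynomial K (reorientation T (deletion R N)))
    q hK uN) /=.
  + by rewrite !mulr0 !mulr1 !addr0 expr1n mul1r !divr1.
  + move=> R S T n part nodd.
    rewrite strict_char_polynomialE //; last first.
      exact: (pattern_polynomial_deletion hK R uN).
    rewrite -natrX -natrM (pattern_count_deletion _ R n uN); congr _%:R.
    by apply: eq_pattern_count => a [[]|]; case: (a \in R); case: (a \in T).
  + by rewrite !mulr0 !addr0 oner_eq0.
(* Zero is now allowed on all three sets, so its weight becomes [1 + y + z]. *)
- move=> s0; rewrite (partition_identity (bR := predT) (bS := predC1 (Some false))
    (bT := predC1 (Some true)) (e := fun R => (rk N - rk (deletion R N))%N)
    (cp := fun R T => weak_char_polynomial K (reorientation T (deletion R N)))
    q hK uN) /=.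
  + by rewrite !mulr0 !mulr1 !addr0.
  + move=> R S T n part nodd.
    rewrite weak_char_polynomialE //; last first.
      exact: (pattern_polynomial_deletion hK R uN).
    rewrite -natrX -natrM (pattern_count_deletion _ R n uN); congr _%:R.
    by apply: eq_pattern_count => a [[]|]; case: (a \in R); case: (a \in T).
  + by rewrite !mulr1.
(* The factor [q ^+ 0] brings the sum into the general form. Values on [R] must vanish, so the
   weights are 1, y and z. *)
- under eq_bigr => R _ do under eq_bigr => S _ do under eq_bigr => T _ do
    rewrite -[y ^+ #|S| * z ^+ #|T|]mulr1 -[1](expr0 q).
  rewrite (partition_identity (bR := pred1 None) (bS := pred1 (Some true))
    (bT := pred1 (Some false)) (e := fun=> 0%N)
    (cp := fun R T => strict_char_polynomial K (reorientation T (contraction R N)))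
    q hK uN) /=.
  + by rewrite !mulr0 !mulr1 !addr0 !add0r expr1n mul1r !divr1.
  + move=> R S T n part nodd; have [RE _ _] := part_sub _ _ _ part.
    rewrite strict_char_polynomialE //; last first.
      exact: (pattern_polynomial_contraction hK RE uN).
    rewrite mul1r (pattern_count_contraction _ n uN RE); congr _%:R.
    by apply: eq_pattern_count => a [[]|]; case: (a \in R); case: (a \in T).
  + by rewrite !mulr0 !addr0 oner_eq0.
(* Values vanish on [R] and zero is allowed everywhere: the weights are [1 + y + z], y and z. *)
- move=> s0; under eq_bigr => R _ do under eq_bigr => S _ do under eq_bigr => T _ do
    rewrite -[y ^+ #|S| * z ^+ #|T|]mulr1 -[1](expr0 q).
  rewrite (partition_identity (bR := pred1 None) (bS := predC1 (Some false))
    (bT := predC1 (Some true)) (e := fun=> 0%N)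
    (cp := fun R T => weak_char_polynomial K (reorientation T (contraction R N)))
    q hK uN) /=.
  + by rewrite !mulr0 !mulr1 !addr0 !add0r.
  + move=> R S T n part nodd; have [RE _ _] := part_sub _ _ _ part.
    rewrite weak_char_polynomialE //; last first.
      exact: (pattern_polynomial_contraction hK RE uN).
    rewrite mul1r (pattern_count_contraction _ n uN RE); congr _%:R.
    by apply: eq_pattern_count => a [[]|]; case: (a \in R); case: (a \in T).
  + by rewrite !mulr1.
Qed.
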